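(* For $k\in\mathbb{N}$ let $I_k:=\int_{(0,\infty)^k}\mathrm{d}u\,\frac{|u|_1e^{-|u|_1}}{\prod_{j=1}^k(u_j+u_{j+1})}$, with $u_{k+1}:=u_1$ and $|u|_1:=u_1+\dots+u_k$ for $u\in(0,\infty)^k$. Then for every $n\in\mathbb{N}$ with $n\ge2$, \[ I_n=(2\pi)^{n-2}\frac{\big(\Gamma(\tfrac n2)\big)^2}{\Gamma(n)}, \] and for every $n\in\mathbb{N}$, \[ I_{2n}=(2\pi)^{2n-2}\frac{[(n-1)!]^2}{(2n-1)!}=nJ_{2n},\qquad J_{2n}:=\pi^{2(n-1)}2^{2n-1}\frac{[(n-1)!]^2}{(2n)!}. \]
   Context: $\Gamma$ denotes Euler's Gamma function. *)

(* Defs.v *)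
From HB Require Import structures.
From mathcomp Require Import all_boot all_order all_algebra.
From mathcomp Require Import all_classical all_reals all_analysis.
Set Implicit Arguments. Unset Strict Implicit. Unset Printing Implicit Defensive.
Import Order.TTheory GRing.Theory Num.Theory.
Local Open Scope classical_set_scope.
Local Open Scope ring_scope.

Definition vcons (R : realType) (x : R) (v : nat -> R) : nat -> R :=
  fun i => if i is j.+1 then v j else x.

(* Lebesgue integral over (0,oo)^k of f (written as an iterated integral,
   coordinates u_0, ..., u_{k-1}); for nonnegative measurable f this equals
   the integral w.r.t. k-dimensional Lebesgue measure (Tonelli). *)
Fixpoint int_pos (R : realType) (k : nat) (f : (nat -> R) -> \bar R) : \bar R :=
  match k with
  | 0 => f (fun _ => 0)
  | k'.+1 => (\int[@lebesgue_measure R]_(x in `]0%R, +oo[) int_pos k' (fun v => f (vcons x v)))%E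
  end.

Definition norm1 (R : realType) (k : nat) (u : nat -> R) : R := \sum_(j < k) u j.

(* I_k, indices shifted to 0..k-1, with u_k := u_0 *)
Definition Ik (R : realType) (k : nat) : \bar R :=
  int_pos k (fun u => (norm1 k u * expR (- norm1 k u)
                        / \prod_(j < k) (u j + u ((j.+1) %% k)%N))%:E).

Definition Gamma (R : realType) (s : R) : R :=
  fine (\int[@lebesgue_measure R]_(x in `]0%R, +oo[) (x `^ (s - 1) * expR (- x))%:E)%E.

(* Main.v *)
Require Import Defs.
From HB Require Import structures.
From mathcomp Require Import all_boot all_order all_algebra.
From mathcomp Require Import all_classical all_reals all_analysis.
From mathcomp Require Import measurable_realfun ring lra.
Set Implicit Arguments. Unset Strict Implicit. Unset Printing Implicit Defensive.
Import Order.TTheory GRing.Theory Num.Theory.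
Import numFieldNormedType.Exports.
Local Open Scope classical_set_scope.
Local Open Scope ring_scope.

(* By homogeneity the radial variable can be integrated out of I_n, which leaves
   the n-fold iterated kernel 1 / (x + y) at x = y = 1.  With x = exp s it becomes
   g^{*n}(0), the n-fold convolution power of g(t) = 1 / (2 cosh (t / 2)).
   Multiplication by t is a derivation of the convolution algebra.  Writing
   d = t g, the two identities
     t^2 g = 2 g^{*3} - pi^2 g   and   d * d = g^{*4} - pi^2 g^{*2}
   (the differential equation of the Fourier transform pi / cosh (pi xi) of g and
   its first integral) give
     t^2 g^{*n} = n (n + 1) g^{*(n + 2)} - n^2 pi^2 g^{*n},
   and at t = 0 the recursion (n + 1) I_{n+2} = n pi^2 I_n, which the Gamma
   quotient also satisfies.  The first identity follows from
   (g * g)(t) = t / (2 sinh (t / 2)) and addition formulas; the constant pi^2 is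
   the square of the integral of g. *)

(** On the Fourier side y = pi / cosh (pi xi) satisfies y'' = pi^2 y - 2 y^3 with first integral
    y'^2 = pi^2 y^2 - y^4, and the recursion is the expansion of (y^n)''. No Fourier transform is
    formed: multiplication by t replaces differentiation, and each identity is proved for the
    functions themselves. The obstacle is the point 0: the recursion is wanted exactly there, and an
    identity multiplied by t says nothing at 0. Hence convolutions are compared at every point, not
    almost everywhere, and the missing values at 0 come from the substitution u -> 2 u combined with
    double angle formulas. That substitution is also how pi^2 enters: it turns g^{*3}(0) into a
    multiple of the integral of g * g. *)

Local Notation mu := lebesgue_measure.

(** * Affine substitutions in Lebesgue integrals *)

(** The push-forward of Lebesgue measure along [a * x + b], rescaled by [a], gives half-open
    intervals their length, so by uniqueness it is Lebesgue measure. *)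
Lemma ge0_integral_affine (R : realType) (a b : R) (f : R -> \bar R) :
  0 < a -> measurable_fun [set: R] f -> (forall x, 0 <= f x)%E ->
  (a%:E * \int[mu]_x f (a * x + b)%R = \int[mu]_x f x)%E.
Proof.
move=> a0 mf f0.
pose phi := (fun x : R => a * x + b) : measurableTypeR R -> measurableTypeR R.
have mphi : measurable_fun [set: measurableTypeR R] phi.
  apply: measurable_funD => //; exact: mulrl_measurable.
transitivity (a%:E * \int[mu]_(x in phi @^-1` setT) (f \o phi) x)%E.
  by rewrite preimage_setT.
rewrite -ge0_integral_pushforward//.
rewrite -[a in LHS]/((NngNum (ltW a0))%:num) -ge0_integral_mscale//.
apply: eq_measure_integral => //= A mA _.
apply/esym/lebesgue_measure_unique => //= _ [[x y]] _ <-.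
rewrite /mscale/= /pushforward /=.
have -> : phi @^-1` `]x, y] = `](x - b) / a, (y - b) / a]%classic.
  apply/seteqP; split => u /=; rewrite /phi !in_itv/= ltr_pdivrMr// ler_pdivlMr//;
    by move=> /andP[? ?]; apply/andP; split; lra.
rewrite !lebesgue_measure_itv/= !lte_fin ltr_pM2r ?invr_gt0// ltrD2r.
case: ifPn => _; last by rewrite mule0.
by rewrite -!EFinB -EFinM; congr EFin; field; rewrite gt_eqF.
Qed.

Lemma ge0_integral_opp (R : realType) (f : R -> \bar R) :
  measurable_fun [set: R] f -> (forall x, 0 <= f x)%E ->
  (\int[mu]_x f (- x)%R = \int[mu]_x f x)%E.
Proof.
move=> mf f0.
transitivity (\int[mu]_(x in (-%R : _ -> measurableTypeR R) @^-1` setT) (f \o -%R) x)%E.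
  by rewrite preimage_setT.
rewrite -ge0_integral_pushforward//.
by apply: eq_measure_integral => //= A mA _; rewrite lebesgue_measureN.
Qed.

Lemma integral_reflect (R : realType) (c : R) (f : R -> \bar R) :
  measurable_fun [set: R] f -> (\int[mu]_x f (c - x)%R = \int[mu]_x f x)%E.
Proof.
have H (h : R -> \bar R) : measurable_fun [set: R] h -> (forall x, 0 <= h x)%E ->
    (\int[mu]_x h (c - x)%R = \int[mu]_x h x)%E.
  move=> mh h0.
  rewrite -(@ge0_integral_affine R 1 c h)// mul1e.
  rewrite -(@ge0_integral_opp R (fun x => h (1 * x + c))) //.
    by apply: eq_integral => x _; congr h; ring.
  by apply: (measurableT_comp mh); apply: measurable_funD.
move=> mf; rewrite integralE [RHS]integralE; congr (_ - _)%E.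
- rewrite -[RHS]H //; last exact: measurable_funepos.
  by apply: eq_integral => x _; rewrite !funeposE.
- rewrite -[RHS]H //; last exact: measurable_funeneg.
  by apply: eq_integral => x _; rewrite !funenegE.
Qed.

Lemma integral_shift (R : realType) (c : R) (f : R -> \bar R) :
  measurable_fun [set: R] f -> (\int[mu]_x f (x + c)%R = \int[mu]_x f x)%E.
Proof.
move=> mf; rewrite -(integral_reflect 0) //.
rewrite -[RHS](integral_reflect c) //.
  by apply: eq_integral => x _; congr f; ring.
by apply: (measurableT_comp mf); exact: measurable_funD.
Qed.

Lemma mem_pos (R : realType) (x : R) : (x \in `]0%R, +oo[%classic) = (0 < x).
Proof. by apply/idP/idP; rewrite inE /= in_itv/= andbT. Qed.

Lemma integral_pos_mkcond (R : realType) (f : R -> \bar R) :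
  (\int[mu]_(x in `]0%R, +oo[) f x =
   \int[mu]_x (if (0 < x)%R then f x else 0))%E.
Proof.
by rewrite integral_mkcond; apply: eq_integral => x _; rewrite patchE mem_pos.
Qed.

Lemma measurable_pos_mkcond d (T : measurableType d) (R : realType)
    (g : T -> R) (f : T -> \bar R) :
  measurable_fun [set: T] g -> measurable_fun [set: T] f ->
  measurable_fun [set: T] (fun x => if 0 < g x then f x else 0%E).
Proof.
move=> mg mf; apply: measurable_fun_ifT => //.
exact: measurable_fun_ltr.
Qed.

Lemma ge0_integral_pos_scale (R : realType) (a : R) (f : R -> \bar R) :
  0 < a -> measurable_fun [set: R] f -> (forall x, 0 <= f x)%E ->
  (a%:E * \int[mu]_(x in `]0%R, +oo[) f (a * x)%R =
   \int[mu]_(x in `]0%R, +oo[) f x)%E.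
Proof.
move=> a0 mf f0; rewrite !integral_pos_mkcond.
rewrite -(@ge0_integral_affine R a 0 (fun x => if 0 < x then f x else 0%E) a0).
- congr (_ * _)%E; apply: eq_integral => x _.
  by rewrite addr0 pmulr_rgt0.
- by apply: measurable_pos_mkcond => //; exact: measurable_id.
- by move=> x; case: ifP.
Qed.

(** * Convolution of bounded integrable functions *)

(** Boundedness of one factor and integrability of the other make the convolution integral converge
    at every point, so that values at [0] are meaningful; the class is also stable under
    convolution. *)
Definition L1Loo (R : realType) (f : R -> R) :=
  [/\ measurable_fun [set: R] f, mu.-integrable [set: R] (EFin \o f) &
      exists M, forall x, `|f x| <= M].

Definition conv (R : realType) (f h : R -> R) (t : R) : R :=
  fine (\int[mu]_u (f u * h (t - u))%:E)%E.

Lemma measurable_conv_integrand (R : realType) (f h : R -> R) (t : R) :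
  measurable_fun [set: R] f -> measurable_fun [set: R] h ->
  measurable_fun [set: R] (fun u => f u * h (t - u)).
Proof.
move=> mf mh; apply: measurable_funM => //; apply: (measurableT_comp mh).
exact: measurable_funB.
Qed.

Lemma integrable_conv_integrand (R : realType) (f h : R -> R) (t : R) :
  L1Loo f -> L1Loo h ->
  mu.-integrable [set: R] (fun u => (f u * h (t - u))%:E).
Proof.
move=> [mf If _] [mh _ [M hM]].
apply: (le_integrable measurableT _ _ (integrableZl measurableT M If)).
  by apply/measurable_EFinP; exact: measurable_conv_integrand.
move=> u _ /=; rewrite lee_fin !normrM mulrC ler_wpM2r//.
by rewrite (le_trans (hM _))// ler_norm.
Qed.

Lemma EFin_conv (R : realType) (f h : R -> R) (t : R) : L1Loo f -> L1Loo h ->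
  (conv f h t)%:E = (\int[mu]_u (f u * h (t - u))%:E)%E.
Proof.
move=> gf gh; rewrite /conv fineK//.
exact: integrable_fin_num (integrable_conv_integrand t gf gh).
Qed.

(** Integrating the absolute value in [t] first and translating by [u] leaves the product of the two
    L1 norms. *)
Lemma integrable_conv_prod (R : realType) (f h : R -> R) : L1Loo f -> L1Loo h ->
  ((@lebesgue_measure R) \x (@lebesgue_measure R))%E.-integrable setT
    (fun z : R * R => (f z.2 * h (z.1 - z.2))%:E).
Proof.
move=> [mf If _] [mh Ih _].
apply/integrable21ltyP.
  apply/measurable_EFinP/measurable_funM.
    by apply: (measurableT_comp mf); exact: measurable_snd.
  apply: (measurableT_comp mh); apply: measurable_funB.
    exact: measurable_fst.
  exact: measurable_snd.
have mnh : measurable_fun [set: R] (fun x => `|h x|%:E).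
  by apply/measurable_EFinP; exact: measurableT_comp.
have mnf : measurable_fun [set: R] (fun x => `|f x|%:E).
  by apply/measurable_EFinP; exact: measurableT_comp.
have -> : (\int[mu]_u \int[mu]_t `|(f u * h (t - u))%:E| =
           \int[mu]_u (`|f u|%:E * \int[mu]_t `|h t|%:E))%E.
  apply: eq_integral => u _.
  rewrite -(integral_shift (- u) mnh) -ge0_integralZl//.
  - by apply: eq_integral => t _; rewrite abse_EFin normrM EFinM.
  - apply: (measurableT_comp mnh); exact: measurable_funB.
rewrite ge0_integralZr//; last by apply: integral_ge0.
move/integrableP : If => [_ /= If]; move/integrableP : Ih => [_ /= Ih].
by rewrite lte_mul_pinfty// ?integral_ge0// ge0_fin_numE// integral_ge0.
Qed.

Lemma L1Loo_conv (R : realType) (f h : R -> R) :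
  L1Loo f -> L1Loo h -> L1Loo (conv f h).
Proof.
move=> gf gh; have I := integrable_conv_prod gf gh.
have E : EFin \o conv f h =
    fubini_F mu (fun z : R * R => (f z.2 * h (z.1 - z.2))%:E).
  by apply/funext => t /=; rewrite EFin_conv.
split.
- apply/measurable_EFinP; rewrite E.
  exact: (measurable_fubini_F I).
- rewrite E; exact: (integrable_fubini_F I).
- case: (gf) (gh) => mf If _ [mh Ih [M hM]].
  exists (fine (\int[mu]_u (`|f u|%:E * M%:E))%E) => t.
  have IM : mu.-integrable [set: R] (fun u => (`|f u|%:E * M%:E))%E.
    by apply: integrableZr => //; exact: integrable_norm.
  rewrite -lee_fin fineK; last exact: integrable_fin_num.
  rewrite -abse_EFin EFin_conv//.
  apply: (le_trans (le_abse_integral _ _ _)) => //.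
    by apply/measurable_EFinP; exact: measurable_conv_integrand.
  apply: ge0_le_integral => //.
  - apply: measurableT_comp => //.
    by apply/measurable_EFinP; exact: measurable_conv_integrand.
  - exact: (measurable_int _ IM).
  - by move=> u _; rewrite abse_EFin normrM -EFinM lee_fin ler_wpM2l.
Qed.

Lemma L1LooD (R : realType) (f h : R -> R) :
  L1Loo f -> L1Loo h -> L1Loo (fun x => f x + h x).
Proof.
move=> [mf If [M fM]] [mh Ih [N hN]]; split.
- exact: measurable_funD.
- exact: (integrableD measurableT If Ih).
- by exists (M + N) => x; rewrite (le_trans (ler_normD _ _))// lerD.
Qed.

Lemma L1LooZ (R : realType) (c : R) (f : R -> R) :
  L1Loo f -> L1Loo (fun x => c * f x).
Proof.
move=> [mf If [M fM]]; split.
- exact: measurable_funM.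
- exact: (integrableZl measurableT c If).
- by exists (`|c| * M) => x; rewrite normrM ler_wpM2l.
Qed.

Lemma convC (R : realType) (f h : R -> R) :
  L1Loo f -> L1Loo h -> conv f h = conv h f.
Proof.
move=> [mf If _] [mh Ih _]; apply/funext => t; rewrite /conv; congr fine.
rewrite -[LHS](integral_reflect t); last first.
  by apply/measurable_EFinP; exact: measurable_conv_integrand.
by apply: eq_integral => u _; rewrite mulrC subKr.
Qed.

Lemma convDl (R : realType) (f h k : R -> R) (t : R) :
  L1Loo f -> L1Loo h -> L1Loo k ->
  conv (fun x => f x + h x) k t = conv f k t + conv h k t.
Proof.
move=> gf gh gk; apply: EFin_inj; rewrite EFinD !EFin_conv//; last exact: L1LooD.
rewrite -integralD//; try exact: integrable_conv_integrand.
by apply: eq_integral => u _; rewrite mulrDl EFinD.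
Qed.

Lemma convZl (R : realType) (c : R) (f k : R -> R) (t : R) :
  L1Loo f -> L1Loo k -> conv (fun x => c * f x) k t = c * conv f k t.
Proof.
move=> gf gk; apply: EFin_inj; rewrite EFinM !EFin_conv//; last exact: L1LooZ.
rewrite -integralZl//; last exact: integrable_conv_integrand.
by apply: eq_integral => u _; rewrite -mulrA EFinM.
Qed.

Lemma convA (R : realType) (f h k : R -> R) : L1Loo f -> L1Loo h -> L1Loo k ->
  conv (conv f h) k = conv f (conv h k).
Proof.
move=> gf gh gk; apply/funext => t; apply: EFin_inj.
rewrite !EFin_conv//; try exact: L1Loo_conv.
case: (gf) (gh) (gk) => mf If _ [mh Ih _] [mk Ik [M kM]].
(* A bound on [k] dominates [G] by a multiple of the integrand of [conv f h] on the plane, so Fubini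
   applies. *)
pose G (z : R * R) := (f z.2 * h (z.1 - z.2) * k (t - z.1))%:E.
have mkt : measurable_fun [set: R] (fun v => k (t - v)).
  by apply: (measurableT_comp mk); exact: measurable_funB.
have I : ((@lebesgue_measure R) \x (@lebesgue_measure R))%E.-integrable setT G.
  have I0 := integrable_conv_prod gf gh.
  apply: (le_integrable measurableT _ _ (integrableZl measurableT M I0)).
    apply/measurable_EFinP/measurable_funM.
      by apply/measurable_EFinP; exact: (measurable_int _ I0).
    by apply: (measurableT_comp mkt); exact: measurable_fst.
  move=> z _ /=; rewrite lee_fin normrM [in leRHS]normrM mulrC ler_wpM2r//.
  by rewrite (le_trans (kM _))// ler_norm.
transitivity (\int[mu]_v \int[mu]_u G (v, u))%E.
  apply: eq_integral => v _; rewrite EFinM EFin_conv// -integralZr//.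
  exact: integrable_conv_integrand.
rewrite (Fubini I); apply: eq_integral => u _; rewrite EFinM EFin_conv//.
rewrite -integralZl//; last exact: integrable_conv_integrand.
rewrite -[RHS](integral_shift (- u)); last first.
  apply/measurable_EFinP/measurable_funM => //.
  exact: measurable_conv_integrand.
apply: eq_integral => v _; rewrite /G/= -EFinM -mulrA.
by congr (_ * (_ * k _))%:E; ring.
Qed.

Definition mulX (R : realType) (f : R -> R) : R -> R := fun x => x * f x.

(** The Leibniz rule: split the factor [t] as [u + (t - u)] under the integral. *)
Lemma mulX_conv (R : realType) (f h : R -> R) (t : R) :
  L1Loo f -> L1Loo h -> L1Loo (mulX f) -> L1Loo (mulX h) ->
  mulX (conv f h) t = conv (mulX f) h t + conv f (mulX h) t.
Proof.
move=> gf gh gXf gXh; apply: EFin_inj; rewrite EFinD EFinM !EFin_conv//.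
rewrite -integralZl//; last exact: integrable_conv_integrand.
rewrite -integralD//; try exact: integrable_conv_integrand.
apply: eq_integral => u _; rewrite -EFinM -EFinD /mulX; congr EFin; ring.
Qed.

Lemma L1Loo_mulX_conv (R : realType) (f h : R -> R) :
  L1Loo f -> L1Loo h -> L1Loo (mulX f) -> L1Loo (mulX h) -> L1Loo (mulX (conv f h)).
Proof.
move=> gf gh gXf gXh.
have -> : mulX (conv f h) = (fun t => conv (mulX f) h t + conv f (mulX h) t).
  by apply/funext => t; exact: mulX_conv.
by apply: L1LooD; exact: L1Loo_conv.
Qed.

(** * Improper integrals *)

Lemma ge0_FTC_cy (R : realType) (f F : R -> R) (c l : R) :
  (forall x, 0 <= f x) -> continuous f -> (forall x : R, is_derive x 1 F (f x)) ->
  F x @[x --> +oo] --> l ->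
  (\int[mu]_(x in `[c, +oo[) (f x)%:E = (l - F c)%:E)%E.
Proof.
move=> f0 cf dF Fl; rewrite (@ge0_continuous_FTC2y R f F c l)//.
- by apply: continuous_subspaceT.
- apply: cvg_at_right_filter; apply: differentiable_continuous.
  by apply/derivable1_diffP; exact: (@ex_derive _ _ _ _ _ _ _ (dF c)).
- by move=> x _; rewrite derive1E; exact: (@derive_val _ _ _ _ _ _ _ (dF x)).
Qed.

Lemma ge0_FTC_Nyc (R : realType) (f F : R -> R) (c l : R) :
  (forall x, 0 <= f x) -> continuous f -> (forall x : R, is_derive x 1 F (f x)) ->
  F x @[x --> -oo] --> l ->
  (\int[mu]_(x in `]-oo, c]) (f x)%:E = (F c - l)%:E)%E.
Proof.
move=> f0 cf dF Fl; rewrite -[c]opprK ge0_integration_by_substitutionNy//.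
- have dG (x : R) : is_derive x 1 (fun x => - F (- x)) ((f \o -%R) x).
    have dFx := dF (- x); apply: is_derive_eq.
    by rewrite mulrN1 opprK.
  rewrite (@ge0_FTC_cy R (f \o -%R) (fun x => - F (- x)) (- c) (- l) _ _ dG).
  + by rewrite !opprK addrC.
  + by move=> x /=.
  + by move=> x; apply: continuous_comp; [exact: opp_continuous|exact: cf].
  + by apply: cvgN; move/cvgNy_compNP : Fl.
- exact: continuous_subspaceT.
Qed.

Lemma ge0_FTC_line (R : realType) (f F : R -> R) (a b : R) :
  (forall x, 0 <= f x) -> continuous f -> (forall x : R, is_derive x 1 F (f x)) ->
  F x @[x --> -oo] --> a -> F x @[x --> +oo] --> b ->
  (\int[mu]_x (f x)%:E = (b - a)%:E)%E.
Proof.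
move=> f0 cf dF Fa Fb.
have mf : measurable_fun [set: R] (EFin \o f).
  by apply/measurable_EFinP; exact: continuous_measurable_fun.
rewrite (_ : setT = `]-oo, 0%R] `|` `]0%R, +oo[); last first.
  apply/seteqP; split=> x //= _; rewrite !in_itv/= andbT.
  by case: (leP x 0); [left|right].
rewrite ge0_integral_setU//=.
- rewrite integral_itv_obnd_cbnd; last exact: measurable_funTS.
  rewrite (ge0_FTC_Nyc 0 f0 cf dF Fa) (ge0_FTC_cy 0 f0 cf dF Fb) -EFinD.
  by congr EFin; ring.
- exact: measurable_funTS.
- by move=> x _; rewrite lee_fin.
- apply/disj_setPRL => x /=; rewrite !in_itv/= andbT => x0.
  by apply/negP; rewrite -ltNge.
Qed.

Lemma cvgy_expR (R : realType) : @expR R x @[x --> +oo] --> +oo.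
Proof.
apply: (@ger_cvgy _ _ _ _ id) => //.
by near=> x; rewrite (le_trans _ (expR_ge1Dx x))// lerDr.
Unshelve. all: by end_near. Qed.

Lemma cvgNy_expR (R : realType) : @expR R x @[x --> -oo] --> 0.
Proof. by apply/cvgNy_compNP; exact: cvgr_expR. Qed.

(** The function g of the overview. Written with exponentials, hyperbolic identities become rational
    identities that [field] can check. *)
Definition sech2 (R : realType) (t : R) : R := (expR (t / 2) + expR (- (t / 2)))^-1.

Lemma sech2_gt0 (R : realType) (t : R) : 0 < sech2 t.
Proof. by rewrite invr_gt0 addr_gt0// expR_gt0. Qed.

Lemma sech2N (R : realType) (t : R) : sech2 (- t) = sech2 t.
Proof. by rewrite /sech2 mulNr opprK addrC. Qed.

Lemma sech2_le1 (R : realType) (t : R) : sech2 t <= 1.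
Proof.
rewrite invf_le1 ?addr_gt0 ?expR_gt0//.
have := expR_ge1Dx (t / 2); have := expR_ge1Dx (- (t / 2)); lra.
Qed.

Lemma continuous_sech2 (R : realType) : continuous (@sech2 R).
Proof.
move=> t; apply: cvgV; first by rewrite gt_eqF// addr_gt0// expR_gt0.
apply: cvgD; (apply: continuous_comp; last exact: continuous_expR).
  by apply: cvgM; [exact: cvg_id|exact: cvg_cst].
by apply: cvgN; apply: cvgM; [exact: cvg_id|exact: cvg_cst].
Qed.

Lemma measurable_sech2 (R : realType) : measurable_fun [set: R] (@sech2 R).
Proof. by apply: continuous_measurable_fun; exact: continuous_sech2. Qed.

Lemma sech2E (R : realType) (t : R) : sech2 t = expR (t / 2) / (1 + expR t).
Proof.
rewrite /sech2 [in RHS](_ : t = t / 2 + t / 2) ?expRD ?expRN; last by field.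
rewrite -[X in expR X / _](_ : t / 2 = _); last by field.
field.
by rewrite !gt_eqF ?addr_gt0 ?mulr_gt0 ?expR_gt0.
Qed.

(** * The exponential substitution *)

Lemma integral_expRN (R : realType) :
  (\int[mu]_(x in `]0%R, +oo[) (expR (- x : R))%:E = 1)%E.
Proof.
rewrite integral_itv_obnd_cbnd; last first.
  apply/measurable_EFinP; apply: (measurableT_comp (@measurable_expR R)).
  exact: measurable_funTS.
have dF (x : R) : is_derive x 1 (fun x => - expR (- x)) (expR (- x)).
  by apply: is_derive_eq; rewrite mulrN1 opprK.
rewrite (@ge0_FTC_cy R (fun x => expR (- x)) (fun x => - expR (- x)) 0 (- 0) _ _ dF).
- by rewrite oppr0 expR0 opprK add0r.
- by move=> x; rewrite expR_ge0.
- by move=> x; apply: continuous_comp; [exact: opp_continuous|exact: continuous_expR].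
- by apply: cvgN; exact: cvgr_expR.
Qed.

Lemma integral_expR_expR (R : realType) :
  (\int[mu]_t (expR t * expR (- expR t : R))%:E = 1)%E.
Proof.
have dF (x : R) : is_derive x 1 (fun t => - expR (- expR t)) (expR x * expR (- expR x)).
  by apply: is_derive_eq; rewrite mulrN opprK mulrC.
rewrite (@ge0_FTC_line R _ (fun t => - expR (- expR t)) (- expR (- 0)) (- 0) _ _ dF).
- by rewrite oppr0 expR0 opprK add0r.
- by move=> x; rewrite mulr_ge0// expR_ge0.
- move=> x; apply: cvgM; first exact: continuous_expR.
  apply: continuous_comp; last exact: continuous_expR.
  by apply: continuous_comp; [exact: continuous_expR|exact: opp_continuous].
- apply: cvgN; apply: (cvg_comp (fun x => - expR x) expR).
    by apply: cvgN; exact: cvgNy_expR.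
  exact: continuous_expR.
- apply: cvgN; apply: (cvg_comp expR (fun x => expR (- x))).
    exact: cvgy_expR.
  exact: cvgr_expR.
Qed.

(* Both sides are invariant functionals of [f], so Tonelli's theorem applied to
   [f (exp t) * w (exp (- t) * y)] shows that they agree up to the factor they
   give to [w y = exp (- y)], which is [1] for both. *)
Lemma ge0_integral_expR (R : realType) (f : R -> \bar R) :
  measurable_fun [set: R] f -> (forall x, 0 <= f x)%E ->
  (\int[mu]_(x in `]0%R, +oo[) f x =
   \int[mu]_t ((expR t)%:E * f (expR t)))%E.
Proof.
move=> mf f0.
pose D : set R := `]0, +oo[%classic.
pose w (x : R) := (expR (- x))%:E.
have mD : measurable D by exact: measurable_itv.
have mw : measurable_fun [set: R] w.
  by apply/measurable_EFinP; apply: (measurableT_comp (@measurable_expR R)).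
have w0 x : (0 <= w x)%E by rewrite lee_fin expR_ge0.
have memD (y : R) : (y \in D) = (0 < y) by exact: mem_pos.
have pge0 (h : R -> \bar R) : (forall x, 0 <= h x)%E -> forall x : R, (0 <= (h \_ D) x)%E.
  by move=> h0 x; rewrite patchE; case: ifP.
have pm (h : R -> \bar R) : measurable_fun [set: R] h ->
    measurable_fun [set: R] (h \_ D : R -> \bar R).
  by move=> mh; apply/(measurable_restrictT _ mD); exact: measurable_funTS.
have pM (h : R -> \bar R) (a y : R) : 0 < a ->
    ((h \_ D) (a * y)%R = (fun y => h (a * y)%R) \_ D y)%E.
  by move=> a0; rewrite !patchE !memD pmulr_rgt0.
have mE : measurable_fun [set: R] (@expR R) by exact: measurable_expR.
have scale (h : R -> \bar R) (a : R) :
    measurable_fun [set: R] h -> (forall x, 0 <= h x)%E -> 0 < a ->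
    (\int[mu]_y (h \_ D) (a * y)%R = (a^-1)%:E * \int[mu]_(y in D) h y)%E.
  move=> mh h0 a0; rewrite -(ge0_integral_pos_scale a0 mh h0).
  rewrite muleA -EFinM mulVf ?gt_eqF// mul1e [in RHS]integral_mkcond.
  by apply: eq_integral => y _; rewrite pM.
have sw : (\int[mu]_(y in D) w y = 1)%E by exact: integral_expRN.
have mexpN : measurable_fun [set: R] (fun t : R => expR (- t)).
  exact: (measurableT_comp mE).
transitivity (\int[mu]_t \int[mu]_y (f (expR t) * (w \_ D) (expR (- t) * y)%R))%E; last first.
  apply: eq_integral => t _; rewrite ge0_integralZl//; first last.
  - by move=> y _; exact: pge0.
  - by apply: (measurableT_comp (pm _ mw)); exact: mulrl_measurable.
  by rewrite scale ?expR_gt0// sw mule1 expRN invrK muleC.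
pose H (z : R * R) := (f (expR z.1) * (w \_ D) (expR (- z.1) * z.2)%R)%E.
have mH : measurable_fun [set: R * R] H.
  apply: emeasurable_funM.
    by apply: (measurableT_comp mf); apply: (measurableT_comp mE); exact: measurable_fst.
  apply: (measurableT_comp (pm _ mw)); apply: measurable_funM.
    by apply: (measurableT_comp mexpN); exact: measurable_fst.
  exact: measurable_snd.
rewrite (fubini_tonelli (m1 := mu) (m2 := mu) H)//; last first.
  by move=> z; apply: mule_ge0 => //; exact: pge0.
pose K (z : R * R) := (w (expR (- z.2)) * (f \_ D) (expR z.2 * z.1)%R)%E.
have mK : measurable_fun [set: R * R] K.
  apply: emeasurable_funM.
    by apply: (measurableT_comp mw); apply: (measurableT_comp mexpN); exact: measurable_snd.
  apply: (measurableT_comp (pm _ mf)); apply: measurable_funM.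
    by apply: (measurableT_comp mE); exact: measurable_snd.
  exact: measurable_fst.
transitivity (\int[mu]_y \int[mu]_t K (y, t))%E; last first.
  apply: eq_integral => y _; rewrite /H /K /=.
  have [y0|y0] := ltP 0 y; last first.
    by rewrite !integral0_eq// => t _; rewrite pM ?expR_gt0// patchE memD ltNge y0 mule0.
  (* Translating [t] by [ln y] moves the variable [y] from the argument of [w] to that of [f]. *)
  rewrite -[RHS](integral_shift (ln y)).
    apply: eq_integral => t _; rewrite !pM ?expR_gt0//.
    have yD : y \in D by rewrite memD.
    rewrite !patchE !yD opprD !expRD expRN lnK ?posrE// muleC.
    by rewrite (expRN (ln y)) lnK ?posrE// mulrC -mulrA mulVf ?mulr1 ?gt_eqF// expRN.
  apply: emeasurable_funM.
    exact: (measurableT_comp mf).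
  apply: (measurableT_comp (pm _ mw)); apply: measurable_funM => //.
have K0 z : (0 <= K z)%E by apply: mule_ge0 => //; exact: pge0.
rewrite (fubini_tonelli (m1 := mu) (m2 := mu) K mK K0).
under [RHS]eq_integral => t _.
  rewrite /K /= ge0_integralZl//; first last.
  - by move=> y _; exact: pge0.
  - by apply: (measurableT_comp (pm _ mf)); exact: mulrl_measurable.
  rewrite scale ?expR_gt0//.
  over.
rewrite -/D; set I := (\int[mu]_(x in D) f x)%E.
under [RHS]eq_integral do rewrite muleA.
rewrite ge0_integralZr//; last 3 first.
- apply: emeasurable_funM; first exact: (measurableT_comp mw).
  by apply/measurable_EFinP; under eq_fun do rewrite -expRN.
- by move=> t _; rewrite mule_ge0// lee_fin invr_ge0 expR_ge0.
- by apply: integral_ge0 => x _; exact: f0.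
suff -> : (\int[mu]_t (w (expR (- t)) * ((expR t)^-1)%:E) = 1)%E by rewrite mul1e.
rewrite -integral_expR_expR -ge0_integral_opp.
- by apply: eq_integral => t _; rewrite (expRN t) invrK opprK /w -EFinM mulrC.
- apply: emeasurable_funM; first exact: (measurableT_comp mw).
  by apply/measurable_EFinP; under eq_fun do rewrite -expRN.
- by move=> t; rewrite mule_ge0// lee_fin invr_ge0 expR_ge0.
Qed.

(** * The hyperbolic secant and its convolution square *)

Lemma expR_half (R : realType) (t : R) : expR t = expR (t / 2) * expR (t / 2).
Proof. by rewrite -expRD -splitr. Qed.

Lemma integral_sech2 (R : realType) : (\int[mu]_t (@sech2 R t)%:E = pi%:E)%E.
Proof.
have dF (t : R) : is_derive t 1 (fun t => 2 * atan (expR (t / 2))) (sech2 t).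
  apply: is_derive_eq.
  rewrite sech2E (expR_half t) /GRing.scale/=; field.
  by rewrite gt_eqF// addr_gt0 ?mulr_gt0 ?exprn_gt0 ?expR_gt0.
rewrite (@ge0_FTC_line R _ (fun t => 2 * atan (expR (t / 2))) (2 * atan 0) (2 * (pi / 2)) _ _ dF).
- by rewrite atan0 mulr0 subr0 mulrC divfK.
- by move=> t; rewrite ltW ?sech2_gt0.
- exact: continuous_sech2.
- apply: cvgMr; apply: (cvg_comp (fun t : R => expR (t / 2)) atan).
    apply: (cvg_comp (fun t : R => t / 2) expR); last exact: cvgNy_expR.
    by apply: gt0_cvgMlNy; [rewrite invr_gt0|exact: cvg_id].
  exact: continuous_atan.
- apply: cvgMr; apply: (cvg_comp (fun t : R => expR (t / 2)) atan).
    apply: (cvg_comp (fun t : R => t / 2) expR); last exact: cvgy_expR.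
    by apply: gt0_cvgMly; [rewrite invr_gt0|exact: cvg_id].
  exact: cvgy_atan.
Qed.

Lemma L1Loo_sech2 (R : realType) : L1Loo (@sech2 R).
Proof.
split.
- exact: measurable_sech2.
- apply/integrableP; split; first by apply/measurable_EFinP; exact: measurable_sech2.
  under eq_integral do rewrite /= ger0_norm ?(ltW (sech2_gt0 _))//.
  by rewrite integral_sech2 ltry.
- by exists 1 => t; rewrite ger0_norm ?sech2_le1// ltW ?sech2_gt0.
Qed.

Lemma is_derive_ln_expR (R : realType) (a u : R) : 0 < a ->
  is_derive u 1 (fun u => ln (a + expR u)) (expR u / (a + expR u)).
Proof.
move=> a0; have p : 0 < a + expR u by rewrite addr_gt0 ?expR_gt0.
have dl := is_derive1_ln p.
have dg : is_derive u 1 (fun u => a + expR u) (expR u).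
  by apply: is_derive_eq; rewrite add0r mul1r.
by have := @is_derive1_comp R (@ln R) _ u _ _ dl dg; rewrite mulrC.
Qed.

(* [t / (2 sinh (t / 2))], extended by its limit at [0]. *)
Definition xcsch2 (R : realType) (t : R) : R :=
  if t == 0 then 1 else t / (expR (t / 2) - expR (- (t / 2))).

Lemma sinh2_neq0 (R : realType) (t : R) : t != 0 ->
  expR (t / 2) - expR (- (t / 2)) != 0.
Proof.
move=> t0; rewrite subr_eq0; apply/eqP => /expR_inj /eqP.
by rewrite -subr_eq0 opprK -splitr (negbTE t0).
Qed.

Lemma continuous_sech2M (R : realType) (t : R) :
  continuous (fun u => sech2 u * sech2 (t - u)).
Proof.
move=> u; apply: cvgM; first exact: continuous_sech2.
apply: (@continuous_comp _ _ _ (fun u => t - u) (@sech2 R)); last exact: continuous_sech2.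
by apply: cvgB; [exact: cvg_cst|exact: cvg_id].
Qed.

(** In the variable [expR u] the integrand is rational (up to the factor from [du]) with poles at
    [-1] and [- expR t]. For [t != 0] partial fractions give a difference of logarithms with
    coefficient [c]; for [t = 0] the poles merge and the primitive is rational in [expR u]. *)
Lemma conv_sech2 (R : realType) : conv (@sech2 R) (@sech2 R) = @xcsch2 R.
Proof.
apply/funext => t; apply: EFin_inj; rewrite EFin_conv; try exact: L1Loo_sech2.
have ge0 u : 0 <= sech2 u * sech2 (t - u) by rewrite mulr_ge0// ltW ?sech2_gt0.
rewrite /xcsch2; case: eqVneq => [t0|t0].
  have dF (u : R) : is_derive u 1 (fun u => - (1 + expR u)^-1) (sech2 u * sech2 (t - u)).
    have p : 1 + expR u != 0 by rewrite gt_eqF ?addr_gt0 ?expR_gt0.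
    have dV := is_deriveV (f := fun u => 1 + expR u) (x := u) (v := 1) p.
    apply: is_derive_eq.
    rewrite t0 sub0r sech2N sech2E /GRing.scale/= (expR_half u); field.
    by rewrite gt_eqF// addr_gt0// mulr_gt0// expR_gt0.
  rewrite (@ge0_FTC_line R _ (fun u => - (1 + expR u)^-1) (- (1 + 0)^-1) (- 0)
    ge0 (@continuous_sech2M R t) dF).
  - by rewrite addr0 invr1 opprK oppr0 add0r.
  - apply: cvgN; apply: cvgV; first by rewrite addr0 oner_eq0.
    by apply: cvgD; [exact: cvg_cst|exact: cvgNy_expR].
  - rewrite (_ : (fun u => _) = (fun u => - (expR (- u) / (1 + expR (- u))))); last first.
      apply/funext => u; rewrite expRN; field.
      by rewrite !gt_eqF ?addr_gt0 ?expR_gt0.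
    apply: cvgN; rewrite -[X in _ --> X](mul0r (1 + 0 : R)^-1).
    apply: cvgM; first exact: cvgr_expR.
    apply: cvgV; first by rewrite addr0 oner_eq0.
    by apply: cvgD; [exact: cvg_cst|exact: cvgr_expR].
set c := (expR (t / 2) - expR (- (t / 2)))^-1.
have dF (u : R) : is_derive u 1 (fun u => c * (ln (1 + expR u) - ln (expR t + expR u)))
    (sech2 u * sech2 (t - u)).
  have d1 := is_derive_ln_expR u (@ltr01 R).
  have d2 := is_derive_ln_expR u (expR_gt0 t).
  apply: is_derive_eq; rewrite /GRing.scale/= /c /sech2.
  have := sinh2_neq0 t0.
  set a := expR (u / 2); set b := expR ((t - u) / 2).
  have -> : expR (t / 2) = a * b by rewrite /a /b -expRD; congr expR; field.
  have -> : expR (- (t / 2)) = (a * b)^-1.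
    by rewrite /a /b -expRD -expRN; congr expR; field.
  have -> : expR t = a * a * (b * b) by rewrite /a /b -!expRD; congr expR; field.
  have -> : expR u = a * a by rewrite /a -!expRD; congr expR; field.
  rewrite !expRN -/a -/b.
  have a0 : 0 < a by rewrite expR_gt0.
  have b0 : 0 < b by rewrite expR_gt0.
  move=> ab; field.
  have -> : a * b * (a * b) - 1 = (a * b - (a * b)^-1) * (a * b).
    by field; rewrite !gt_eqF.
  by rewrite !mulf_neq0 ?ab// !gt_eqF ?addr_gt0 ?mulr_gt0.
rewrite (@ge0_FTC_line R _ (fun u => c * (ln (1 + expR u) - ln (expR t + expR u)))
  (c * (ln (1 + 0) - ln (expR t + 0))) (c * (ln (1 + 0) - ln (1 + 0)))
  ge0 (@continuous_sech2M R t) dF).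
- by rewrite !addr0 ln1 expRK subr0 mulr0 sub0r sub0r mulrN opprK mulrC.
- apply: cvgMr; apply: cvgB.
    apply: (cvg_comp (fun u => 1 + expR u) (@ln R));
    last by apply: continuous_ln; rewrite addr0.
    by apply: cvgD; [exact: cvg_cst|exact: cvgNy_expR].
  apply: (cvg_comp (fun u => expR t + expR u) (@ln R));
    last by apply: continuous_ln; rewrite addr0 expR_gt0.
  by apply: cvgD; [exact: cvg_cst|exact: cvgNy_expR].
(* Both logarithms diverge at [+oo]; factoring [expR u] out of each argument cancels the
   divergence. *)
- rewrite (_ : (fun u => _) = 
      (fun u => c * (ln (1 + expR (- u)) - ln (1 + expR t * expR (- u))))); last first.
    apply/funext => u; congr (_ * _).
    have -> : 1 + expR u = (1 + expR (- u)) * expR u.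
      by rewrite mulrDl mul1r -expRD addNr expR0 addrC.
    have -> : expR t + expR u = (1 + expR t * expR (- u)) * expR u.
      by rewrite mulrDl mul1r -mulrA -expRD addNr expR0 mulr1 addrC.
    rewrite !lnM ?posrE ?expR_gt0 ?addr_gt0 ?mulr_gt0 ?expR_gt0//.
    by ring.
  apply: cvgMr; apply: cvgB.
    apply: (cvg_comp (fun u => 1 + expR (- u)) (@ln R));
    last by apply: continuous_ln; rewrite addr0.
    by apply: cvgD; [exact: cvg_cst|exact: cvgr_expR].
  rewrite -[X in 1 + X](mulr0 (expR t)).
  apply: (cvg_comp (fun u => 1 + expR t * expR (- u)) (@ln R));
    last by apply: continuous_ln; rewrite mulr0 addr0.
  by apply: cvgD; [exact: cvg_cst|apply: cvgMr; exact: cvgr_expR].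
Qed.

(** * Hyperbolic identities behind the convolution formulas *)

Lemma xcsch2N (R : realType) (t : R) : xcsch2 (- t) = xcsch2 t.
Proof.
rewrite /xcsch2 oppr_eq0; case: eqVneq => // t0.
by rewrite !mulNr opprK -[in RHS]opprB invrN mulrN.
Qed.

Lemma sinh2_xcsch2 (R : realType) (t : R) :
  (expR (t / 2) - expR (- (t / 2))) * xcsch2 t = t.
Proof.
rewrite /xcsch2; case: eqVneq => [->|t0].
  by rewrite mul0r oppr0 subrr mul0r.
by rewrite mulrC divfK// sinh2_neq0.
Qed.

(** This is [2 sinh (u/2) cosh (u/2) = sinh u]. It makes the integral for g^{*3}(0) a rescaled
    integral of [xcsch2]. *)
Lemma sech2_xcsch2 (R : realType) (u : R) :
  sech2 u * xcsch2 u = xcsch2 (2 * u) / 2.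
Proof.
rewrite /xcsch2 mulf_eq0 pnatr_eq0/=; case: eqVneq => [->|u0].
  by rewrite /sech2 mul0r oppr0 expR0 mulr1 mul1r.
have := sinh2_neq0 u0; rewrite /sech2 -[2 * u]mulrC mulfK//.
have -> : expR u = expR (u / 2) * expR (u / 2) by rewrite -expRD -splitr.
have -> : expR (- u) = (expR (u / 2) * expR (u / 2))^-1.
  by rewrite -expRD -splitr expRN.
rewrite expRN; set a := expR _ => h.
have a0 : 0 < a by rewrite expR_gt0.
field.
have E : a * a - 1 = (a - a^-1) * a by field; rewrite gt_eqF.
have E2 : a * a * (a * a) - 1 = (a - a^-1) * a * (a * a + 1) by field; rewrite gt_eqF.
have n : a * a + 1 != 0 by rewrite gt_eqF ?addr_gt0 ?mulr_gt0.
by rewrite n E2 E !mulf_neq0// gt_eqF.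
Qed.

(** This is [cosh^2 - sinh^2 = 1] divided by [sinh^2 cosh^2], with the double angle formula on the
    right. *)
Lemma xcsch2_sqr (R : realType) (u : R) :
  xcsch2 u ^+ 2 - (u * sech2 u) ^+ 2 = xcsch2 (2 * u) ^+ 2.
Proof.
have <- : 2 * (sech2 u * xcsch2 u) = xcsch2 (2 * u).
  by rewrite sech2_xcsch2 mulrC divfK.
rewrite /xcsch2; case: eqVneq => [->|u0].
  by rewrite /sech2 !mul0r oppr0 expR0; field.
have := sinh2_neq0 u0; rewrite /sech2.
rewrite expRN; set a := expR _ => h.
have a0 : 0 < a by rewrite expR_gt0.
field.
have E : a * a - 1 = (a - a^-1) * a by field; rewrite gt_eqF.
have n : a * a + 1 != 0 by rewrite gt_eqF ?addr_gt0 ?mulr_gt0.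
by rewrite ?n ?E !mulf_neq0// gt_eqF.
Qed.

(** The addition formula [cosh (t/2) cosh (u/2) = cosh ((t-u)/2) + sinh (t/2) sinh (u/2)], divided
    by the hyperbolic factors. The first term on the right does not involve [t], so its integral in
    [u] is a constant. *)
Lemma cosh2_xcsch2_sech2 (R : realType) (t u : R) :
  (expR (t / 2) + expR (- (t / 2))) / 2 * (xcsch2 u * sech2 (t - u)) =
  sech2 u * xcsch2 u
  + (expR (t / 2) - expR (- (t / 2))) / 2 * (u * sech2 u * sech2 (t - u)).
Proof.
rewrite /sech2 !expRN.
have -> : expR (t / 2) = expR (u / 2) * expR ((t - u) / 2).
  by rewrite -expRD; congr expR; field.
rewrite /xcsch2; case: eqVneq => [->|u0].
  rewrite mul0r subr0 expR0; set a := expR _.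
  have a0 : 0 < a by rewrite expR_gt0.
  field.
  by rewrite ?gt_eqF ?addr_gt0 ?mulr_gt0.
have := sinh2_neq0 u0; rewrite expRN; set a := expR _; set b := expR _ => h.
have a0 : 0 < a by rewrite expR_gt0.
have b0 : 0 < b by rewrite expR_gt0.
field.
have E : a * a - 1 = (a - a^-1) * a by field; rewrite gt_eqF.
have n : a * a + 1 != 0 by rewrite gt_eqF ?addr_gt0 ?mulr_gt0.
have n' : b * b + 1 != 0 by rewrite gt_eqF ?addr_gt0 ?mulr_gt0.
have na : a != 0 by rewrite gt_eqF.
have nb : b != 0 by rewrite gt_eqF.
by rewrite n n' E na nb mulf_neq0.
Qed.

(** * Recursion for the convolution powers *)

Lemma integral_conv (R : realType) (f h : R -> R) : L1Loo f -> L1Loo h ->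
  (\int[mu]_t (conv f h t)%:E = (\int[mu]_t (f t)%:E) * \int[mu]_t (h t)%:E)%E.
Proof.
move=> gf gh; case: (gf) (gh) => mf If _ [mh Ih _].
under eq_integral do rewrite EFin_conv//.
rewrite (Fubini (integrable_conv_prod gf gh)).
have Hfin : (\int[mu]_t (h t)%:E)%E \is a fin_num by exact: (integrable_fin_num _ Ih).
rewrite -[X in (_ = _ * X)%E]fineK// -integralZr//.
apply: eq_integral => u _; rewrite fineK//.
rewrite -(@integral_shift R (- u) (EFin \o h)); last exact/measurable_EFinP.
rewrite -integralZl//; last first.
  apply/integrableP; split.
    by apply/measurable_EFinP; apply: (measurableT_comp mh); exact: measurable_funD.
  move/integrableP : Ih => [_]; apply: le_lt_trans.
  rewrite -(@integral_shift R (- u) (fun x => `|(h x)%:E|%E))//.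
  by apply: measurableT_comp => //; exact/measurable_EFinP.
Qed.

(* Index shift: [sech2_conv R n] is the [n.+1]-fold convolution power of [sech2]. *)
Fixpoint sech2_conv (R : realType) (n : nat) : R -> R :=
  if n is m.+1 then conv (@sech2 R) (@sech2_conv R m) else @sech2 R.
Arguments sech2_conv R n : clear implicits.

Lemma L1Loo_sech2_conv (R : realType) n : L1Loo (sech2_conv R n).
Proof. by elim: n => [|n IH] /=; [|apply: L1Loo_conv => //]; exact: L1Loo_sech2. Qed.

Lemma L1Loo_xcsch2 (R : realType) : L1Loo (@xcsch2 R).
Proof. by rewrite -conv_sech2; exact: (L1Loo_sech2_conv R 1). Qed.

(** Since [sinh <= cosh], the convolution square of [sech2] dominates [mulX sech2], which inherits
    its boundedness and integrability. *)
Lemma mulX_sech2_le (R : realType) (t : R) : `|mulX (@sech2 R) t| <= xcsch2 t.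
Proof.
wlog t0 : t / 0 <= t => [H|].
  have [/H//|/ltW t0] := leP 0 t.
  rewrite -xcsch2N; apply: le_trans (H (- t) _); last by rewrite oppr_ge0.
  by rewrite /mulX sech2N mulNr normrN.
rewrite /mulX /xcsch2; case: eqVneq => [->|tn0]; first by rewrite mul0r normr0.
have tp : 0 < t by rewrite lt_neqAle eq_sym tn0.
rewrite ger0_norm; last by rewrite mulr_ge0// ltW// sech2_gt0.
rewrite /sech2 ler_pM2l// lef_pV2 ?posrE.
- by rewrite lerD2l ge0_cp// expR_ge0.
- by rewrite addr_gt0 ?expR_gt0.
- by rewrite subr_gt0 ltr_expR; lra.
Qed.

Lemma L1Loo_mulX_sech2 (R : realType) : L1Loo (mulX (@sech2 R)).
Proof.
have [_ I [M hM]] := L1Loo_xcsch2 R.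
have m : measurable_fun [set: R] (mulX (@sech2 R)).
  by apply: measurable_funM => //; exact: measurable_sech2.
split => //.
  apply: (le_integrable measurableT _ _ I); first exact/measurable_EFinP.
  by move=> t _ /=; rewrite lee_fin (le_trans (mulX_sech2_le t))// ler_norm.
by exists M => t; rewrite (le_trans (mulX_sech2_le t))// (le_trans _ (hM t))// ler_norm.
Qed.

(** The two terms of the derivation rule for the convolution square agree by commutativity, so each
    is half of the total. *)
Lemma conv_mulX_sech2 (R : realType) (t : R) :
  conv (mulX (@sech2 R)) (@sech2 R) t = t * xcsch2 t / 2.
Proof.
have gg := L1Loo_sech2 R; have gd := L1Loo_mulX_sech2 R.
have := mulX_conv t gg gg gd gd; rewrite (convC gg gd) conv_sech2 /mulX => ->.
by field.
Qed.

(* [sech2 u * xcsch2 u = xcsch2 (2 u) / 2], and [xcsch2] is the convolution square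
   of [sech2], whose integral is [pi]. *)
Lemma conv_xcsch2_sech2_0 (R : realType) :
  conv (@xcsch2 R) (@sech2 R) 0 = pi ^+ 2 / 4.
Proof.
have gg := L1Loo_sech2 R; have gx := L1Loo_xcsch2 R.
apply: EFin_inj; rewrite EFin_conv//.
have mx : measurable_fun [set: R] (fun x : R => (xcsch2 x)%:E).
  by apply/measurable_EFinP; case: gx.
have x0 (t : R) : 0 <= xcsch2 t by exact: le_trans (normr_ge0 _) (mulX_sech2_le t).
transitivity (\int[mu]_u ((2^-1 : R)%:E * (xcsch2 (2 * u + 0))%:E))%E.
  apply: eq_integral => u _.
  by rewrite sub0r sech2N mulrC sech2_xcsch2 addr0 mulrC EFinM.
rewrite ge0_integralZl//; last 2 first.
- apply: (measurableT_comp mx); apply: measurable_funD => //; exact: mulrl_measurable.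
- by move=> u _; rewrite lee_fin.
have two0 : (0 : R) < 2 by [].
have E := @ge0_integral_affine R 2 0 (fun x => (xcsch2 x)%:E) two0 mx x0.
have {E} : (\int[mu]_x (xcsch2 (2 * x + 0 : R))%:E = (2^-1 * pi ^+ 2)%:E)%E.
  have : (\int[mu]_x (xcsch2 (x : R))%:E = (pi ^+ 2)%:E)%E.
    by rewrite -conv_sech2 integral_conv// !integral_sech2 -EFinM.
  move=> E2; rewrite E2 in E.
  by rewrite EFinM -E muleA -EFinM mulVf// mul1e.
move=> ->; rewrite -EFinM; congr EFin; by field.
Qed.

(** A closed form of g^{*3}. Integrating the addition formula in [u] leaves the value at [0] plus
    [S] times a known convolution, in which the hyperbolic sine cancels; dividing by [C] produces
    [sech2 t]. *)
Lemma conv_xcsch2_sech2 (R : realType) (t : R) :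
  conv (@xcsch2 R) (@sech2 R) t = (pi ^+ 2 + t ^+ 2) / 2 * sech2 t.
Proof.
have gg := L1Loo_sech2 R; have gx := L1Loo_xcsch2 R; have gd := L1Loo_mulX_sech2 R.
set C := (expR (t / 2) + expR (- (t / 2))) / 2.
set S := (expR (t / 2) - expR (- (t / 2))) / 2.
have E : C * conv (@xcsch2 R) (@sech2 R) t
    = pi ^+ 2 / 4 + S * conv (mulX (@sech2 R)) (@sech2 R) t.
  apply: EFin_inj; rewrite EFinD -conv_xcsch2_sech2_0 !EFinM !EFin_conv//.
  rewrite -!integralZl//; try exact: integrable_conv_integrand.
  rewrite -integralD//; last 2 first.
  - exact: integrable_conv_integrand.
  - by apply: integrableZl => //; exact: integrable_conv_integrand.
  apply: eq_integral => u _; rewrite -!EFinM -EFinD; congr EFin.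
  by rewrite cosh2_xcsch2_sech2 sub0r sech2N [xcsch2 u * _]mulrC.
rewrite conv_mulX_sech2 in E.
have E2 : S * (t * xcsch2 t / 2) = t ^+ 2 / 4.
  have := sinh2_xcsch2 t; rewrite /S; move: (_ - _) (xcsch2 t) => s x sx.
  by rewrite expr2 -{3}sx; field.
rewrite E2 in E.
have C0 : C != 0 by rewrite gt_eqF// divr_gt0// addr_gt0 ?expR_gt0.
apply: (mulfI C0); rewrite E.
have -> : sech2 t = (2 * C)^-1 by rewrite /sech2 /C; congr (_^-1); field.
by field.
Qed.

Lemma mulX_mulX_sech2 (R : realType) :
  mulX (mulX (@sech2 R)) =
  (fun t => 2 * sech2_conv R 2 t + (- pi ^+ 2) * sech2 t).
Proof.
have gg := L1Loo_sech2 R; have gx := L1Loo_xcsch2 R.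
apply/funext => t /=; rewrite conv_sech2 (convC gg gx) conv_xcsch2_sech2 /mulX.
by field.
Qed.

(** Read off the right-hand side of the identity instead of a decay estimate for [sech2]. *)
Lemma L1Loo_mulX_mulX_sech2 (R : realType) : L1Loo (mulX (mulX (@sech2 R))).
Proof.
by rewrite mulX_mulX_sech2; apply: L1LooD; apply: L1LooZ;
  [exact: L1Loo_sech2_conv|exact: L1Loo_sech2].
Qed.

Lemma L1Loo_mulX_sech2_conv (R : realType) n : L1Loo (mulX (sech2_conv R n)).
Proof.
elim: n => [|n IH] /=; first exact: L1Loo_mulX_sech2.
by apply: L1Loo_mulX_conv => //;
  [exact: L1Loo_sech2|exact: L1Loo_sech2_conv|exact: L1Loo_mulX_sech2].
Qed.

(** The power rule for a derivation of a commutative algebra; the factor is [n.+2] because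
    [sech2_conv R n.+1] is a power with that exponent. *)
Lemma mulX_sech2_conv (R : realType) n (t : R) :
  mulX (sech2_conv R n.+1) t =
  n.+2%:R * conv (mulX (@sech2 R)) (sech2_conv R n) t.
Proof.
have gg := L1Loo_sech2 R; have gd := L1Loo_mulX_sech2 R.
have gP := L1Loo_sech2_conv R; have gXP := L1Loo_mulX_sech2_conv R.
elim: n t => [|n IH] t.
  by rewrite /= mulX_conv// (convC gg gd); ring.
rewrite -[sech2_conv R n.+2]/(conv (@sech2 R) (sech2_conv R n.+1)) mulX_conv//.
have -> : mulX (sech2_conv R n.+1) =
    (fun t => n.+2%:R * conv (mulX (@sech2 R)) (sech2_conv R n) t).
  by apply/funext => s; exact: IH.
have gc : L1Loo (conv (mulX (@sech2 R)) (sech2_conv R n)) by exact: L1Loo_conv.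
rewrite (convC gg); last exact: L1LooZ.
rewrite convZl// (convC gc gg) -convA// (convC gg gd) convA//=.
by rewrite -[n.+3%:R]natr1; ring.
Qed.

Lemma conv_mulX2_sech2 (R : realType) (h : R -> R) (t : R) : L1Loo h ->
  conv (mulX (mulX (@sech2 R))) h t =
  2 * conv (sech2_conv R 2) h t - pi ^+ 2 * conv (@sech2 R) h t.
Proof.
move=> gh; have gg := L1Loo_sech2 R; have gP := L1Loo_sech2_conv R.
rewrite mulX_mulX_sech2 convDl//; [|exact: L1LooZ|exact: L1LooZ].
by rewrite !convZl// mulNr.
Qed.

Lemma conv_sech2_conv2 (R : realType) (h : R -> R) : L1Loo h ->
  conv (sech2_conv R 2) h = conv (@sech2 R) (conv (@sech2 R) (conv (@sech2 R) h)).
Proof.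
move=> gh; have gg := L1Loo_sech2 R; have gP := L1Loo_sech2_conv R.
by rewrite /= !convA//; try exact: L1Loo_conv; exact: (gP 1).
Qed.

(* The unknown [sech2_conv R 3 0] is the integral [Z] of [xcsch2 ^+ 2].  By
   [xcsch2_sqr] and the substitution [u -> 2 * u], [Z = - dd + Z / 2], while the
   derivation rule at [0] expresses [dd] through [Z]. *)
Lemma conv_mulX_sech2_sqr0 (R : realType) :
  conv (mulX (@sech2 R)) (mulX (@sech2 R)) 0 =
  sech2_conv R 3 0 - pi ^+ 2 * sech2_conv R 1 0.
Proof.
have gg := L1Loo_sech2 R; have gx := L1Loo_xcsch2 R; have gd := L1Loo_mulX_sech2 R.
have ge := L1Loo_mulX_mulX_sech2 R; have gP := L1Loo_sech2_conv R.
set dd := conv _ _ _.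
have P1 : sech2_conv R 1 0 = 1 by rewrite /= conv_sech2 /xcsch2 eqxx.
have P3 : sech2_conv R 3 0 = conv (@xcsch2 R) (@xcsch2 R) 0.
  by rewrite -conv_sech2 /= convA//; exact: L1Loo_conv.
have H1 : dd = - (2 * sech2_conv R 3 0 - pi ^+ 2).
  have := mulX_conv 0 gd gg ge gd; rewrite {1}/mulX mul0r -/dd.
  rewrite conv_mulX2_sech2// conv_sech2_conv2// -/(sech2_conv R 1) P1 mulr1.
  by rewrite -/(sech2_conv R 2) -/(sech2_conv R 3); lra.
have x0 (t : R) : 0 <= xcsch2 t by exact: le_trans (normr_ge0 _) (mulX_sech2_le t).
have H2 : sech2_conv R 3 0 = - dd + sech2_conv R 3 0 / 2.
  (* As [mulX sech2] is odd, [- dd] is the integral of the square of [u * sech2 u]. With the sign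
     moved inside, all integrands are nonnegative. *)
  have gn : L1Loo (fun x => -1 * mulX (@sech2 R) x) by exact: L1LooZ.
  rewrite P3 -mulN1r -convZl//; apply: EFin_inj.
  rewrite EFinD [X in (_ + X)%E](_ : _ =
      \int[mu]_u (xcsch2 (2 * u) * xcsch2 (0 - 2 * u))%:E)%E; last first.
    have mx : measurable_fun [set: R] (fun u : R => (xcsch2 u * xcsch2 (0 - u))%:E).
      by apply/measurable_EFinP; case: gx => m _ _; exact: measurable_conv_integrand.
    have two0 : (0 : R) < 2 by [].
    have E := @ge0_integral_affine R 2 0 _ two0 mx.
    rewrite mulrC EFinM EFin_conv// -E.
      rewrite muleA -EFinM mulVf// mul1e.
      by apply: eq_integral => u _; rewrite addr0.
    by move=> u; rewrite lee_fin mulr_ge0.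
  rewrite !EFin_conv// -ge0_integralD//.
  - apply: eq_integral => u _; rewrite -EFinD; congr EFin.
    rewrite !sub0r !xcsch2N /mulX sech2N -!expr2 -xcsch2_sqr; ring.
  - move=> u _; rewrite lee_fin sub0r /mulX sech2N.
    by rewrite (_ : _ * _ = (u * sech2 u) ^+ 2) ?sqr_ge0//; ring.
  - have [mn _ _] := gn; have [md _ _] := gd.
    by apply/measurable_EFinP; exact: measurable_conv_integrand mn md.
  - by move=> u _; rewrite lee_fin mulr_ge0.
  - have [mx _ _] := gx.
    apply/measurable_EFinP/measurable_funM; apply: (measurableT_comp mx).
      exact: mulrl_measurable.
    by apply: measurable_funB => //; exact: mulrl_measurable.
rewrite P1; move: H1 H2; move: (sech2_conv R 3 0) => z; lra.
Qed.

(* Away from [0] it suffices to compare the products by [t], to which the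
   derivation rule and [conv_mulX2_sech2] apply. *)
Lemma conv_mulX_sech2_sqr (R : realType) :
  conv (mulX (@sech2 R)) (mulX (@sech2 R)) =
  (fun t => sech2_conv R 3 t + (- pi ^+ 2) * sech2_conv R 1 t).
Proof.
have gg := L1Loo_sech2 R; have gd := L1Loo_mulX_sech2 R.
have ge := L1Loo_mulX_mulX_sech2 R; have gP := L1Loo_sech2_conv R.
apply/funext => t; have [->|t0] := eqVneq t 0.
  by rewrite conv_mulX_sech2_sqr0 mulNr.
apply: (mulfI t0).
have -> : t * conv (mulX (@sech2 R)) (mulX (@sech2 R)) t =
    2 * conv (mulX (mulX (@sech2 R))) (mulX (@sech2 R)) t.
  by rewrite -[LHS]/(mulX _ t) mulX_conv// (convC gd ge); ring.
have e3 := mulX_sech2_conv 2 t; have e1 := mulX_sech2_conv 0 t.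
rewrite /mulX in e3 e1.
rewrite mulrDr mulrCA e3 e1 conv_mulX2_sech2//.
by rewrite (convC (gP 2) gd) (convC gg gd) -/(mulX _); ring.
Qed.

(** For [n = 0] this is the identity for t^2 g at [0]. Otherwise the derivation rule for the
    convolution of [mulX sech2] with a power has left side [0] at [0]. One term on the right
    contains t^2 g and contributes the coefficient 2, the other contains d * d and contributes the
    exponent of that power. *)
Lemma sech2_conv_rec (R : realType) n :
  n.+2%:R * sech2_conv R n.+2 0 = n.+1%:R * pi ^+ 2 * sech2_conv R n 0.
Proof.
have gg := L1Loo_sech2 R; have gd := L1Loo_mulX_sech2 R.
have ge := L1Loo_mulX_mulX_sech2 R; have gP := L1Loo_sech2_conv R.
have gXP := L1Loo_mulX_sech2_conv R.
case: n => [|n].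
  have := congr1 (fun f => f 0) (mulX_mulX_sech2 R); rewrite /mulX mul0r.
  by move/esym; rewrite -[sech2_conv R 0]/(@sech2 R); lra.
have D : conv (mulX (@sech2 R)) (mulX (sech2_conv R n)) 0 =
    n.+1%:R * (sech2_conv R n.+3 0 - pi ^+ 2 * sech2_conv R n.+1 0).
  (* By the power rule [mulX] of a higher power contains one factor [mulX sech2], to be paired with
     the one in front; for the first power it is that factor itself. *)
  case: n => [|k]; first by rewrite conv_mulX_sech2_sqr mul1r mulNr.
  have -> : mulX (sech2_conv R k.+1) =
      (fun t => k.+2%:R * conv (mulX (@sech2 R)) (sech2_conv R k) t).
    by apply/funext => s; exact: mulX_sech2_conv.
  have gc : L1Loo (conv (mulX (@sech2 R)) (sech2_conv R k)) by exact: L1Loo_conv.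
  rewrite (convC gd); last exact: L1LooZ.
  rewrite convZl// (convC gc gd) -convA// conv_mulX_sech2_sqr.
  rewrite convDl//; [|exact: L1LooZ].
  rewrite convZl// [sech2_conv R 3]/= -/(sech2_conv R 2) convA//.
  by rewrite conv_sech2_conv2// [sech2_conv R 1]/= convA// mulNr.
(* The extra factor [0] is the point of evaluation: absorbed into [mulX] at [0], it gives access to
   the derivation rule, whose expansion is a nontrivial relation. *)
have := congr1 (fun x => 0 * x) (mulX_sech2_conv n (0 : R)).
rewrite mul0r mulrCA -[0 * conv _ _ _]/(mulX (conv _ _) 0) mulX_conv// D.
rewrite conv_mulX2_sech2// conv_sech2_conv2// => /esym/eqP.
rewrite mulf_eq0 pnatr_eq0/= -/(sech2_conv R n.+1) -/(sech2_conv R n.+2) -/(sech2_conv R n.+3).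
move=> /eqP; rewrite -[n.+3%:R]natr1 -[n.+2%:R]natr1; lra.
Qed.

(** * Iterated integrals over the positive orthant *)

Lemma ge0_pos_fubini (R : realType) (H : R * R -> \bar R) :
  measurable_fun [set: R * R] H -> (forall z, 0 <= H z)%E ->
  (\int[mu]_(x in `]0%R, +oo[) \int[mu]_(y in `]0%R, +oo[) H (x, y) =
   \int[mu]_(y in `]0%R, +oo[) \int[mu]_(x in `]0%R, +oo[) H (x, y))%E.
Proof.
move=> mH H0.
pose K (z : R * R) := if 0 < z.1 then (if 0 < z.2 then H z else 0%E) else 0%E.
have mK : measurable_fun [set: R * R] K.
  apply: measurable_pos_mkcond; first exact: measurable_fst.
  by apply: measurable_pos_mkcond => //; exact: measurable_snd.
have K0 z : (0 <= K z)%E by rewrite /K; case: ifP => // _; case: ifP.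
rewrite !integral_pos_mkcond.
transitivity (\int[mu]_x \int[mu]_y K (x, y))%E.
  apply: eq_integral => x _; rewrite /K/=; case: ifP => x0.
    by rewrite integral_pos_mkcond.
  by rewrite integral0.
rewrite (fubini_tonelli (m1 := mu) (m2 := mu) K mK K0).
apply: eq_integral => y _; rewrite /K/= integral_pos_mkcond.
case: ifP => y0; first by [].
by rewrite integral0_eq// => x _; case: ifP.
Qed.

(* Measurability of a function of finitely many coordinates with a parameter in
   [T], tested on all families of measurable functions. *)
Definition pmeasurable d (T : measurableType d) (R : realType)
    (f : T -> (nat -> R) -> \bar R) :=
  forall d' (T' : measurableType d') (tau : T' -> T) (c : T' -> nat -> R),
  measurable_fun [set: T'] tau -> (forall i, measurable_fun [set: T'] (c ^~ i)) ->
  measurable_fun [set: T'] (fun t => f (tau t) (c t)).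

Lemma measurable_vcons d (T : measurableType d) (R : realType)
    (x : T -> R) (c : T -> nat -> R) :
  measurable_fun [set: T] x -> (forall i, measurable_fun [set: T] (c ^~ i)) ->
  forall i, measurable_fun [set: T] (fun t => vcons (x t) (c t) i).
Proof. by move=> mx mc [|i] /=. Qed.

Lemma int_pos_ge0 (R : realType) k (f : (nat -> R) -> \bar R) :
  (forall v, 0 <= f v)%E -> (0 <= int_pos k f)%E.
Proof.
elim: k f => [|k IH] f f0 /=; first exact: f0.
by apply: integral_ge0 => x _; exact: IH.
Qed.

Lemma pmeasurable_vcons d (T : measurableType d) (R : realType)
    (f : T -> (nat -> R) -> \bar R) : pmeasurable f ->
  pmeasurable (fun (p : (T * measurableTypeR R)%type) v => f p.1 (vcons p.2 v)).
Proof.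
move=> mf d' T' tau c mtau mc.
apply: (mf _ _ (fun t => (tau t).1) (fun t => vcons (tau t).2 (c t))).
  by apply: (measurableT_comp measurable_fst).
apply: measurable_vcons => //.
exact: (measurableT_comp measurable_snd).
Qed.

Lemma measurable_int_pos (R : realType) k d (T : measurableType d)
    (f : T -> (nat -> R) -> \bar R) :
  pmeasurable f -> (forall t v, 0 <= f t v)%E ->
  measurable_fun [set: T] (fun t => int_pos k (f t)).
Proof.
elim: k d T f => [|k IH] d T f mf f0 /=.
  by apply: (mf _ _ id (fun=> fun=> 0)).
under eq_fun do rewrite integral_pos_mkcond.
pose H (z : T * measurableTypeR R) :=
  if 0 < z.2 then int_pos k (fun v => f z.1 (vcons z.2 v)) else 0%E.
apply: (measurable_fun_fubini_tonelli_F (m2 := mu) H).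
- apply: measurable_pos_mkcond; first exact: measurable_snd.
  by apply: (IH _ _ (fun (p : (T * measurableTypeR R)%type) v => f p.1 (vcons p.2 v)));
    [exact: pmeasurable_vcons|move=> t v].
- by move=> z; rewrite /H; case: ifP => // _; exact: int_pos_ge0.
Qed.

Lemma eq_int_pos (R : realType) k (f g : (nat -> R) -> \bar R) :
  (forall v, (forall i, (i < k)%N -> 0 < v i) -> f v = g v) ->
  int_pos k f = int_pos k g.
Proof.
elim: k f g => [|k IH] f g fg /=; first exact: fg.
apply: eq_integral => x; rewrite mem_pos => x0; apply: IH => v v0.
by apply: fg => -[|i]//=; rewrite ltnS; exact: v0.
Qed.

Lemma measurable_int_pos_vcons (R : realType) k (f : (nat -> R) -> \bar R) :
  pmeasurable (fun _ : unit => f) -> (forall v, 0 <= f v)%E ->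
  measurable_fun [set: measurableTypeR R] (fun x => int_pos k (fun v => f (vcons x v))).
Proof.
move=> mf f0; apply: (@measurable_int_pos R k _ _ (fun x v => f (vcons x v))) => //.
move=> d' T' tau c mtau mc.
by apply: (mf _ _ (fun=> tt) (fun t => vcons (tau t) (c t))) => //; exact: measurable_vcons.
Qed.

Lemma pmeasurable_cst_vcons (R : realType) (f : (nat -> R) -> \bar R) (x : R) :
  pmeasurable (fun _ : unit => f) -> pmeasurable (fun _ : unit => fun v => f (vcons x v)).
Proof.
move=> mf d' T' tau c mtau mc.
by apply: (mf _ _ (fun=> tt) (fun t => vcons x (c t))) => //; exact: measurable_vcons.
Qed.

Lemma int_posZl (R : realType) k (a : R) (f : (nat -> R) -> \bar R) : 0 <= a ->
  pmeasurable (fun _ : unit => f) -> (forall v, 0 <= f v)%E ->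
  int_pos k (fun v => a%:E * f v)%E = (a%:E * int_pos k f)%E.
Proof.
move=> a0; elim: k f => [|k IH] f mf f0 //=.
rewrite -ge0_integralZl//.
- by apply: eq_integral => x _; rewrite IH//; exact: pmeasurable_cst_vcons.
- by apply: measurable_funTS; exact: measurable_int_pos_vcons.
- by move=> x _; exact: int_pos_ge0.
Qed.

Lemma int_pos_scale (R : realType) k (a : R) (f : (nat -> R) -> \bar R) : 0 < a ->
  pmeasurable (fun _ : unit => f) -> (forall v, 0 <= f v)%E ->
  int_pos k f = ((a ^+ k)%:E * int_pos k (fun v => f (fun i => a * v i)%R))%E.
Proof.
move=> a0; elim: k f => [|k IH] f mf f0 /=.
  by rewrite expr0 mul1e; congr f; apply/funext => i; rewrite mulr0.
have mfs : pmeasurable (fun _ : unit => fun v => f (fun i => a * v i)).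
  move=> d' T' tau c mtau mc.
  by apply: (mf _ _ (fun=> tt) (fun t i => a * c t i)) => // i; exact: measurable_funM.
rewrite -(ge0_integral_pos_scale a0); last 2 first.
- exact: measurable_int_pos_vcons.
- by move=> x; exact: int_pos_ge0.
rewrite exprS EFinM -muleA; congr (_ * _)%E.
rewrite -ge0_integralZl//; last 3 first.
- by apply: measurable_funTS; exact: (measurable_int_pos_vcons k mfs).
- by move=> x _; exact: int_pos_ge0.
- by rewrite lee_fin exprn_ge0// ltW.
apply: eq_integral => x _; rewrite IH//; last exact: pmeasurable_cst_vcons.
congr (_ * _)%E; congr (int_pos k _); apply/funext => v; congr f.
by apply/funext => -[|i].
Qed.

(** Brings the radial variable into the innermost integral, where it can be evaluated in closed
    form. *)
Lemma int_pos_swap (R : realType) k (f : measurableTypeR R -> (nat -> R) -> \bar R) :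
  pmeasurable f -> (forall x v, 0 <= f x v)%E ->
  (\int[mu]_(x in `]0%R, +oo[) int_pos k (f x) =
   int_pos k (fun v => \int[mu]_(x in `]0%R, +oo[) f x v))%E.
Proof.
elim: k f => [|k IH] f mf f0 //=.
pose H (z : R * R) := int_pos k (fun v => f z.1 (vcons z.2 v)).
rewrite (@ge0_pos_fubini R H); last 2 first.
- by apply: (measurable_int_pos k (pmeasurable_vcons mf)).
- by move=> z; exact: int_pos_ge0.
apply: eq_integral => y _; rewrite /H /= IH//.
move=> d' T' tau c mtau mc.
by apply: (mf _ _ tau (fun t => vcons y (c t))) => //; exact: measurable_vcons.
Qed.

(** * The Gamma function *)

(** Euler's integral after [x = expR t], kept in the extended reals so that the functional equation
    can be proved by Tonelli without first establishing convergence. *)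
Definition EGamma (R : realType) (s : R) : \bar R :=
  (\int[mu]_t (expR (s * t) * expR (- expR t))%:E)%E.

Lemma Gamma_EGamma (R : realType) (s : R) : Gamma s = fine (EGamma s).
Proof.
rewrite /Gamma /EGamma; congr fine; rewrite ge0_integral_expR.
- apply: eq_integral => t _; rewrite -EFinM -expRM mulrA; congr EFin; congr (_ * _).
  by rewrite -expRD; congr expR; ring.
- apply/measurable_EFinP/measurable_funM; first exact: measurable_powR.
  exact: (measurableT_comp (@measurable_expR R)).
- by move=> x; rewrite lee_fin mulr_ge0 ?powR_ge0 ?expR_ge0.
Qed.

Lemma continuous_expR_scale (R : realType) (s : R) : continuous (fun t => expR (s * t)).
Proof.
move=> t; apply: (@continuous_comp _ _ _ (fun t => s * t) (@expR R)); last exact: continuous_expR.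
exact: mulrl_continuous.
Qed.

Lemma continuous_expR_expR (R : realType) :
  continuous (fun t : R => expR t * expR (- expR t)).
Proof.
move=> x; apply: cvgM; first exact: continuous_expR.
apply: continuous_comp; last exact: continuous_expR.
by apply: continuous_comp; [exact: continuous_expR|exact: opp_continuous].
Qed.

(* Write [exp (s t)] as the integral of [s exp (s v)] over [v <= t] and exchange. *)
Lemma EGammaS (R : realType) (s : R) : 0 < s ->
  EGamma (s + 1) = (s%:E * EGamma s)%E.
Proof.
move=> s0.
pose a (v : R) := s * expR (s * v).
pose w (t : R) := expR t * expR (- expR t).
have ca : continuous a.
  by move=> t; apply: cvgM; [exact: cvg_cst|exact: continuous_expR_scale].
have cw : continuous w by exact: continuous_expR_expR.
have ma : measurable_fun [set: R] a by exact: continuous_measurable_fun.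
have mw : measurable_fun [set: R] w by exact: continuous_measurable_fun.
have a0 t : 0 <= a t by rewrite mulr_ge0 ?expR_ge0// ltW.
have w0 t : 0 <= w t by rewrite mulr_ge0 ?expR_ge0.
have da (t : R) : is_derive t 1 (fun v => expR (s * v)) (a t).
  by apply: is_derive_eq; rewrite /a /GRing.scale/=; ring.
have dw (t : R) : is_derive t 1 (fun t => - expR (- expR t)) (w t).
  by apply: is_derive_eq; rewrite mulrN opprK mulrC.
have la : expR (s * v) @[v --> -oo] --> (0 : R).
  apply: (cvg_comp (fun v => s * v) (@expR R)); last exact: cvgNy_expR.
  by apply: gt0_cvgMrNy => //; exact: cvg_id.
have lw : - expR (- expR t) @[t --> +oo] --> - (0 : R).
  by apply: cvgN; apply: (cvg_comp (@expR R) (fun x => expR (- x)));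
    [exact: cvgy_expR|exact: cvgr_expR].
pose K (z : R * R) := (if z.2 <= z.1 then (a z.2 * w z.1)%:E else 0%E).
have mK : measurable_fun [set: R * R] K.
  apply: measurable_fun_ifT => //.
    by apply: measurable_fun_ler; [exact: measurable_snd|exact: measurable_fst].
  apply/measurable_EFinP/measurable_funM.
    by apply: (measurableT_comp ma); exact: measurable_snd.
  by apply: (measurableT_comp mw); exact: measurable_fst.
have K0 z : (0 <= K z)%E by rewrite /K; case: ifP => // _; rewrite lee_fin mulr_ge0.
transitivity (\int[mu]_t \int[mu]_v K (t, v))%E.
  apply: eq_integral => t _.
  have -> : (\int[mu]_v K (t, v) = \int[mu]_(v in `]-oo, t]) ((w t)%:E * (a v)%:E))%E.
    rewrite [RHS]integral_mkcond; apply: eq_integral => v _.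
    rewrite /K patchE mem_setE in_itv/=; case: ifP => // _.
    by rewrite mulrC EFinM.
  rewrite ge0_integralZl//; last 3 first.
  - by apply/measurable_EFinP; exact: measurable_funTS.
  - by move=> v _; rewrite lee_fin.
  - by rewrite lee_fin.
  rewrite (ge0_FTC_Nyc t a0 ca da la) subr0 -EFinM /w; congr EFin.
  by rewrite mulrDl mul1r expRD; ring.
rewrite (fubini_tonelli (m1 := mu) (m2 := mu) K mK K0) /EGamma.
rewrite -ge0_integralZl//; last 2 first.
- apply/measurable_EFinP; apply: continuous_measurable_fun => t.
  apply: cvgM; first exact: continuous_expR_scale.
  apply: continuous_comp; last exact: continuous_expR.
  by apply: continuous_comp; [exact: continuous_expR|exact: opp_continuous].
- by rewrite lee_fin ltW.
apply: eq_integral => v _.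
have -> : (\int[mu]_t K (t, v) = \int[mu]_(t in `[v, +oo[) ((a v)%:E * (w t)%:E))%E.
  rewrite [RHS]integral_mkcond; apply: eq_integral => t _.
  by rewrite /K patchE mem_setE in_itv/= andbT; case: ifP => // _.
rewrite ge0_integralZl//; last 3 first.
- by apply/measurable_EFinP; exact: measurable_funTS.
- by move=> t _; rewrite lee_fin.
- by rewrite lee_fin.
by rewrite (ge0_FTC_cy v w0 cw dw lw) oppr0 sub0r opprK -!EFinM mulrA.
Qed.

Lemma GammaS (R : realType) (s : R) : 0 < s -> Gamma (s + 1) = s * Gamma s.
Proof.
move=> s0; rewrite !Gamma_EGamma EGammaS//.
(* At an infinite value [fine] would give [0] on both sides. *)
case: (EGamma s) => [r| |] //=.
  by rewrite mulr0 gt0_muley// lte_fin.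
by rewrite mulr0 gt0_muleNy// lte_fin.
Qed.

Lemma Gamma1 (R : realType) : Gamma (1 : R) = 1.
Proof.
rewrite Gamma_EGamma /EGamma.
under eq_integral do rewrite mul1r.
by rewrite integral_expR_expR.
Qed.

Lemma Gamma_nat (R : realType) n : Gamma (n.+1%:R : R) = n`!%:R.
Proof.
elim: n => [|n IH]; first by rewrite Gamma1 fact0.
by rewrite -natr1 GammaS// IH factS natrM.
Qed.

(** Doubling the logarithmic variable is the substitution [x = y ^+ 2], which yields twice the
    Gaussian integral over the half-line. *)
Lemma Gamma_half (R : realType) : Gamma (2^-1 : R) = Num.sqrt pi.
Proof.
have G : (\int[mu]_(x in `]0%R, +oo[) (gauss_fun (x : R))%:E = (Num.sqrt pi / 2)%:E)%E.
  rewrite integral_itv_obnd_cbnd ?integral0y_gauss//.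
  by apply/measurable_EFinP; exact: measurable_funTS (@measurable_gauss_fun R).
rewrite Gamma_EGamma.
suff -> : EGamma (2^-1 : R) = (Num.sqrt pi)%:E by [].
have m : measurable_fun [set: R] (fun t : R => (expR (2^-1 * t) * expR (- expR t))%:E).
  apply/measurable_EFinP; apply: continuous_measurable_fun => t.
  apply: cvgM; first exact: continuous_expR_scale.
  apply: continuous_comp; last exact: continuous_expR.
  by apply: continuous_comp; [exact: continuous_expR|exact: opp_continuous].
have two0 : (0 : R) < 2 by [].
rewrite /EGamma -(ge0_integral_affine 0 two0 m); last first.
  by move=> t; rewrite lee_fin mulr_ge0 ?expR_ge0.
move: G; rewrite ge0_integral_expR; last 2 first.
- by apply/measurable_EFinP; exact: measurable_gauss_fun.
- by move=> x; rewrite lee_fin gauss_fun_ge0.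
move=> G.
rewrite (_ : (Num.sqrt pi)%:E = (2%:E * (Num.sqrt pi / 2)%:E)%E); last first.
  by rewrite -EFinM; congr EFin; field.
rewrite -G; congr (_ * _)%E; apply: eq_integral => t _.
rewrite -EFinM /gauss_fun; congr (expR _ * expR (- _))%:E; first by field.
by rewrite -expRM_natl addr0.
Qed.

(** * Evaluation of the cyclic integral *)

Lemma sech2_conv_ge0 (R : realType) n (t : R) : 0 <= sech2_conv R n t.
Proof.
elim: n t => [|n IH] t /=; first by rewrite ltW ?sech2_gt0.
rewrite /conv fine_ge0// integral_ge0// => u _.
by rewrite lee_fin mulr_ge0// ltW ?sech2_gt0.
Qed.

(** The cyclic product cut open: the last factor joins [w m] to the fixed endpoint [1], while [w 0]
    stays free, so that the kernel can be iterated by induction on [m]. *)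
Definition chain_prod (R : realType) m (w : nat -> R) : R :=
  \prod_(j < m) (w j + w j.+1) * (w m + 1).

Lemma measurable_chain_prod d (T : measurableType d) (R : realType) m
    (c : T -> nat -> R) : (forall i, measurable_fun [set: T] (c ^~ i)) ->
  measurable_fun [set: T] (fun t => chain_prod m (c t)).
Proof.
move=> mc; apply: measurable_funM; last exact: measurable_funD.
by apply: measurable_prod => j _; exact: measurable_funD.
Qed.

(** Absolute values appear because the lemmas on [int_pos] ask for nonnegativity at all points,
    whereas the integrands are known to be nonnegative on the orthant, where the absolute value
    changes nothing. *)
Lemma measurable_normV d (T : measurableType d) (R : realType) (f : T -> R) :
  measurable_fun [set: T] f -> measurable_fun [set: T] (fun t => `|(f t)^-1|).
Proof.
move=> mf; under eq_fun do rewrite normfV -powR_inv1//.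
by apply: (measurableT_comp (@measurable_powR R (-1))); exact: measurableT_comp.
Qed.

(* With [x = exp s] and [y = exp r], the kernel [1 / (x + y)] is
   [exp (- (s + r) / 2) * sech2 (s - r)], so iterating it is convolving. *)
Lemma int_pos_chain (R : realType) m (s : R) :
  int_pos m (fun v => `|(chain_prod m (vcons (expR s) v))^-1|%:E) =
  (expR (- (s / 2)) * sech2_conv R m s)%:E.
Proof.
have gg := L1Loo_sech2 R; have gP := L1Loo_sech2_conv R.
elim: m s => [|m IH] s /=.
  rewrite /chain_prod big_ord0 mul1r/=; congr EFin.
  rewrite ger0_norm; last by rewrite invr_ge0 addr_ge0// expR_ge0.
  rewrite sech2E mulrA -expRD addNr expR0 mul1r; congr (_^-1); exact: addrC.
pose f (y : R) := (`|(expR s + y)^-1|%:E *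
  (`|expR (- (ln y / 2)) * sech2_conv R m (ln y)|)%:E)%E.
transitivity (\int[mu]_(y in `]0%R, +oo[) f y)%E.
  apply: eq_integral => y; rewrite mem_pos => y0.
  have -> : (fun v => `|(chain_prod m.+1 (vcons (expR s) (vcons y v)))^-1|%:E) =
      (fun v => `|(expR s + y)^-1|%:E * `|(chain_prod m (vcons y v))^-1|%:E)%E.
    apply/funext => v; rewrite -EFinM /chain_prod big_ord_recl/= -mulrA invfM normrM.
    by congr (_ * `|_^-1|)%:E.
  rewrite int_posZl//; last first.
    move=> d' T' tau c mtau mc; apply/measurable_EFinP/measurable_normV.
    apply: measurable_chain_prod; exact: measurable_vcons.
  rewrite /f -[X in vcons X](lnK _) ?posrE// IH; congr (_ * _)%E; rewrite ger0_norm//.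
  by rewrite mulr_ge0 ?expR_ge0 ?sech2_conv_ge0.
rewrite ge0_integral_expR; last 2 first.
- apply: emeasurable_funM; apply/measurable_EFinP.
    by apply: measurable_normV; exact: measurable_funD.
  have mh : measurable_fun [set: R] (fun t : R => `|expR (- (t / 2)) * sech2_conv R m t|).
    apply: measurableT_comp => //; apply: measurable_funM; last by case: (gP m).
    apply: (measurableT_comp (@measurable_expR R)); apply: measurableT_comp => //.
    exact: measurable_funM.
  exact: (measurableT_comp mh (@measurable_ln R)).
- by move=> y; rewrite mule_ge0.
rewrite (convC gg (gP m)) EFinM EFin_conv// -integralZl//; last exact: integrable_conv_integrand.
apply: eq_integral => r _; rewrite /f expRK -!EFinM; congr EFin.
rewrite !ger0_norm ?mulr_ge0 ?invr_ge0 ?addr_ge0 ?expR_ge0 ?sech2_conv_ge0//.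
rewrite [RHS]mulrCA [RHS]mulrC !mulrA; congr (_ * _).
rewrite /sech2.
have -> : (s - r) / 2 = s / 2 - r / 2 by field.
rewrite opprB !expRD !expRN (expR_half s) (expR_half r).
field.
by rewrite !gt_eqF ?addr_gt0 ?mulr_gt0 ?expR_gt0.
Qed.

(** * Homogeneity and the radial integral *)

Definition cyc_prod (R : realType) n (u : nat -> R) : R :=
  \prod_(j < n) (u j + u (j.+1 %% n)%N).

Definition cyc_integrand (R : realType) n (u : nat -> R) : R :=
  norm1 n u * expR (- norm1 n u) / cyc_prod n u.

Lemma cyc_prod_vcons (R : realType) m (v : nat -> R) :
  cyc_prod m.+1 (vcons 1 v) = chain_prod m (vcons 1 v).
Proof.
rewrite /cyc_prod /chain_prod big_ord_recr/= modnn; congr (_ * _).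
by apply: eq_bigr => j _; rewrite modn_small// ltnS.
Qed.

Lemma norm1_scale (R : realType) n (a : R) (u : nat -> R) :
  norm1 n (fun i => a * u i) = a * norm1 n u.
Proof. by rewrite /norm1 mulr_sumr. Qed.

Lemma cyc_prod_scale (R : realType) n (a : R) (u : nat -> R) :
  cyc_prod n (fun i => a * u i) = a ^+ n * cyc_prod n u.
Proof.
rewrite /cyc_prod -[X in a ^+ X](card_ord n) -prodr_const -big_split/=.
by apply: eq_bigr => j _; rewrite mulrDr.
Qed.

Lemma pmeasurable_cyc_integrand (R : realType) n :
  pmeasurable (fun _ : unit => fun u : nat -> R => `|cyc_integrand n u|%:E).
Proof.
move=> d T tau c mtau mc; apply/measurable_EFinP.
have mn : measurable_fun [set: T] (fun t => norm1 n (c t)).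
  by apply: measurable_sum.
have mp : measurable_fun [set: T] (fun t => cyc_prod n (c t)).
  by apply: measurable_prod => j _; exact: measurable_funD.
under eq_fun do rewrite /cyc_integrand normrM.
apply: measurable_funM; last exact: measurable_normV.
apply: measurableT_comp => //; apply: measurable_funM => //.
apply: (measurableT_comp (@measurable_expR R)); exact: measurableT_comp.
Qed.

Lemma cyc_prod_gt0 (R : realType) n (u : nat -> R) :
  (forall i, (i < n)%N -> 0 < u i) -> 0 < cyc_prod n u.
Proof.
move=> u0; apply: prodr_gt0 => j _; rewrite addr_gt0 ?u0 ?ltn_ord//.
by rewrite ltn_mod (leq_ltn_trans _ (ltn_ord j)).
Qed.

Lemma norm1_gt0 (R : realType) n (u : nat -> R) : (0 < n)%N ->
  (forall i, (i < n)%N -> 0 < u i) -> 0 < norm1 n u.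
Proof.
case: n => // n _ u0; rewrite /norm1 big_ord_recl ltr_wpDr ?u0//.
by apply: sumr_ge0 => j _; rewrite ltW// u0//= ltnS.
Qed.

(** On the ray through [w], the Jacobian [x ^+ m] and the degree of the integrand cancel up to
    [S / P * expR (- (S * x))]. The factor [norm1] supplies the [S] that the integral of the
    exponential divides out. *)
Lemma integral_cyc_ray (R : realType) m (v : nat -> R) :
  (forall i, (i < m)%N -> 0 < v i) ->
  (\int[mu]_(x in `]0%R, +oo[)
     (`|x ^+ m|%:E * `|cyc_integrand m.+1 (vcons x (fun i => x * v i))|%:E) =
   `|(chain_prod m (vcons 1 v))^-1|%:E)%E.
Proof.
move=> v0; set w := vcons 1 v.
have w0 i : (i < m.+1)%N -> 0 < w i by case: i => [|i] //; exact: v0.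
have S0 := norm1_gt0 (ltn0Sn m) w0; have P0 := cyc_prod_gt0 w0.
set S := norm1 m.+1 w in S0; rewrite -cyc_prod_vcons -/w.
set P := cyc_prod m.+1 w in P0 *.
transitivity (\int[mu]_(x in `]0%R, +oo[) ((S / P)%:E * (expR (- (S * x)))%:E))%E.
  apply: eq_integral => x; rewrite mem_pos => x0.
  have -> : vcons x (fun i => x * v i) = (fun i => x * w i).
    by apply/funext => -[|i] //=; rewrite mulr1.
  rewrite /cyc_integrand norm1_scale cyc_prod_scale -/S -/P -!EFinM -normrM.
  rewrite ger0_norm; last first.
    by rewrite !mulr_ge0 ?exprn_ge0 ?expR_ge0 ?invr_ge0 ?mulr_ge0 ?exprn_ge0
      ?(ltW x0) ?(ltW S0) ?(ltW P0).
  rewrite (mulrC S x) exprS; congr EFin; field.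
  by rewrite !gt_eqF ?exprn_gt0.
have mE : measurable_fun [set: R] (fun y : R => (expR (- y))%:E).
  by apply/measurable_EFinP; apply: (measurableT_comp (@measurable_expR R)).
have E0 (x : R) : (0 <= (expR (- x))%:E)%E by rewrite lee_fin expR_ge0.
have := ge0_integral_pos_scale S0 mE E0; rewrite integral_expRN => E.
rewrite ge0_integralZl//; last 2 first.
- apply: measurable_funTS; apply: (measurableT_comp mE); exact: mulrl_measurable.
- by rewrite lee_fin divr_ge0 ?ltW.
rewrite mulrC EFinM -muleA E mule1 ger0_norm// invr_ge0 ltW//.
Qed.

(** The first coordinate serves as the radius and the others are measured in its units, with
    Jacobian [x ^+ m]. Both ends of the resulting chain are then [1 = expR 0], whence the value at
    [0]. *)
Lemma Ik_sech2_conv (R : realType) m : (0 < m)%N ->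
  Ik R m.+1 = (sech2_conv R m 0)%:E.
Proof.
move=> m0.
have mF := @pmeasurable_cyc_integrand R m.+1.
transitivity (int_pos m.+1 (fun u : nat -> R => `|cyc_integrand m.+1 u|%:E)).
  apply: eq_int_pos => u u0; rewrite ger0_norm// /cyc_integrand.
  by rewrite divr_ge0 ?mulr_ge0 ?expR_ge0 ?ltW ?norm1_gt0 ?cyc_prod_gt0.
rewrite /=.
transitivity (\int[mu]_(x in `]0%R, +oo[) int_pos m (fun v : nat -> R =>
    (`|x ^+ m|%:E * `|cyc_integrand m.+1 (vcons x (fun i => x * v i))|%:E)))%E.
  apply: eq_integral => x; rewrite mem_pos => x0.
  rewrite (int_pos_scale m x0)//; last exact: (pmeasurable_cst_vcons x mF).
  rewrite int_posZl//; first by rewrite ger0_norm// exprn_ge0// ltW.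
  move=> d' T' tau c mtau mc.
  apply: (mF _ _ (fun=> tt) (fun t => vcons x (fun i => x * c t i))) => //.
  by apply: measurable_vcons => // i; exact: measurable_funM.
rewrite (@int_pos_swap R m (fun x v => (`|x ^+ m|%:E *
  `|cyc_integrand m.+1 (vcons x (fun i => x * v i))|%:E)%E)); last 2 first.
- move=> d' T' tau c mtau mc; apply: emeasurable_funM.
    by apply/measurable_EFinP; apply: measurableT_comp => //; exact: measurable_funX.
  apply: (mF _ _ (fun=> tt) (fun t => vcons (tau t) (fun i => tau t * c t i))) => //.
  by apply: measurable_vcons => // i; exact: measurable_funM.
- by move=> x v; rewrite mule_ge0.
rewrite (eq_int_pos (g := fun v => `|(chain_prod m (vcons (expR 0) v))^-1|%:E)).
  by rewrite int_pos_chain mul0r oppr0 expR0 mul1r.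
by move=> v v0; rewrite expR0 integral_cyc_ray.
Qed.

(** The recursion links indices two apart, so two consecutive cases are carried along; they start
    from [Gamma_half] and [Gamma1]. The factor [2 * pi] clears the exponent -1 that would occur at
    [n = 0]. *)
Lemma sech2_conv0_Gamma (R : realType) n :
  sech2_conv R n 0 * (2 * pi) =
  (2 * pi) ^+ n * Gamma (n.+1%:R / 2) ^+ 2 / Gamma n.+1%:R.
Proof.
suff H : forall n, (sech2_conv R n 0 * (2 * pi) =
    (2 * pi) ^+ n * Gamma (n.+1%:R / 2) ^+ 2 / Gamma n.+1%:R) /\
  (sech2_conv R n.+1 0 * (2 * pi) =
    (2 * pi) ^+ n.+1 * Gamma (n.+2%:R / 2) ^+ 2 / Gamma n.+2%:R) by have [] := H n.
elim=> [|k [IH0 IH1]].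
  split.
    rewrite /= /sech2 mul0r oppr0 expR0 Gamma1 (_ : 1%:R / 2 = 2^-1); last by rewrite mul1r.
    rewrite Gamma_half sqr_sqrtr ?pi_ge0//.
    by rewrite expr0; field.
  rewrite /= conv_sech2 /xcsch2 eqxx divff// Gamma1 (Gamma_nat R 1) (_ : 1`! = 1)%N//.
  by rewrite expr1; field.
split => //.
have k2 : (k.+2%:R : R) != 0 by rewrite pnatr_eq0.
have k1 : (k.+1%:R : R) != 0 by rewrite pnatr_eq0.
have f0 : (k`!%:R : R) != 0 by rewrite pnatr_eq0 -lt0n fact_gt0.
have E : k.+2%:R * (sech2_conv R k.+2 0 * (2 * pi)) =
    k.+1%:R * pi ^+ 2 * (sech2_conv R k 0 * (2 * pi)).
  by rewrite mulrA sech2_conv_rec; ring.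
apply: (mulfI k2); rewrite E IH0.
have -> : (k.+3%:R / 2 : R) = k.+1%:R / 2 + 1.
  by rewrite -[k.+3%:R]natr1 -[k.+2%:R]natr1; field.
rewrite GammaS; last by rewrite divr_gt0.
rewrite !Gamma_nat !factS !natrM !exprS.
move: (Gamma _) k1 k2 f0.
move: (k.+1%:R : R) (k.+2%:R : R) (k`!%:R : R) => a b c G a0 b0 c0.
by field; rewrite a0 b0 c0.
Qed.

Theorem theorem4p26 (R : realType) :
  (forall n : nat, (2 <= n)%N ->
     Ik R n = ((2 * pi) ^+ (n - 2) * (Gamma (n%:R / 2)) ^+ 2 / Gamma n%:R)%:E) /\
  (forall n : nat, (1 <= n)%N ->
     Ik R (2 * n) = ((2 * pi) ^+ (2 * n - 2) * ((n - 1)`!%:R) ^+ 2 / ((2 * n - 1)`!%:R))%:E /\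
     Ik R (2 * n) = (n%:R * (pi ^+ (2 * (n - 1)) * 2 ^+ (2 * n - 1)
                               * ((n - 1)`!%:R) ^+ 2 / ((2 * n)`!%:R)))%:E).
Proof.
have A n : (2 <= n)%N ->
    Ik R n = ((2 * pi) ^+ (n - 2) * (Gamma (n%:R / 2)) ^+ 2 / Gamma n%:R)%:E.
  case: n => [|[|n]]// _; rewrite Ik_sech2_conv//; congr EFin.
  have p0 : (2 * pi : R) != 0 by rewrite gt_eqF// mulr_gt0 ?pi_gt0.
  by apply: (mulIf p0); rewrite sech2_conv0_Gamma subSS subSS subn0 exprS; ring.
split => // -[|n]// _; have E2 : (2 * n.+1 = (2 * n).+2)%N by rewrite mulnS.
have B : Ik R (2 * n.+1) =
    ((2 * pi) ^+ (2 * n.+1 - 2) * ((n.+1 - 1)`!%:R) ^+ 2 / ((2 * n.+1 - 1)`!%:R))%:E.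
  rewrite A; last by rewrite mulnS.
  have -> : ((2 * n.+1)%:R / 2 : R) = n.+1%:R by rewrite natrM; field.
  by rewrite Gamma_nat E2 Gamma_nat !subSS !subn0.
(* The two closed forms differ by [(2 n)! = 2 n (2 n - 1)!] and by collecting the powers of 2. *)
split => //; rewrite B E2 !subSS !subn0; congr EFin.
rewrite [in RHS]factS natrM exprMn [in RHS]exprS.
have f0 : ((2 * n).+1`!%:R : R) != 0 by rewrite pnatr_eq0 -lt0n fact_gt0.
have -> : ((2 * n).+2%:R : R) = 2 * n.+1%:R by rewrite -natrM mulnS.
have n0 : (n.+1%:R : R) != 0 by rewrite pnatr_eq0.
move: f0 n0; move: ((2 * n).+1`!%:R : R) (n.+1%:R : R) => F N f0 n0.
by field; rewrite f0 n0.
Qed.
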